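(* Let $D$ be a regular $\Delta$-matroid on a finite set $E$. Let $R,S_1,\dots,S_t\subseteq E$ and let $a_1,\dots,a_t$ be nonnegative integers. For an integer $i$, let $c_i$ be the number of tuples $(R',S_1',\dots,S_t')$ such that $R'$ is an $i$-element subset of $R$, each $S_j'$ is an $a_j$-element subset of $S_j$, and $R',S_1',\dots,S_t'$ are pairwise disjoint with union a basis of $D$. Then one of the sequences $(c_{2i})_{i\in\mathbb{Z}}$ and $(c_{2i+1})_{i\in\mathbb{Z}}$ is identically zero, and the other is ultra-log-concave with no internal zeros.
   Context: A $\Delta$-matroid is a pair $(E,\mathcal{B})$ with $E$ finite and $\mathcal{B}$ a nonempty family of subsets (bases) such that for all $B,B'\in\mathcal{B}$ and $x\in B\triangle B'$ there is $y\in B\triangle B'$ with $B\triangle\{x,y\}\in\mathcal{B}$. It is even if all bases have the same parity. For a symmetric or skew-symmetric matrix $\mathbf{A}$ over a field $K$ indexed by $E$, $D(\mathbf{A})=(E,\{I\subseteq E:\mathbf{A}[I]\text{ nonsingular}\})$ (with $\mathbf{A}[\emptyset]$ nonsingular); the twist $D*X$ has bases $\{B\triangle X: B\in\mathcal{B}\}$. $D$ is representable over $K$ if $D=D(\mathbf{A})*X$ for some such $\mathbf{A}$ over $K$ and some $X$. $D$ is regular if it is even and representable over every field (equivalently, $D=D(\mathbf{A})*X$ for a real skew-symmetric matrix $\mathbf{A}$ all of whose principal minors are in $\{0,\pm1\}$). For a finitely supported sequence $(a_i)_{i\in\mathbb{Z}}$ of nonnegative reals with $\ell=\min\{i:a_i\neq0\}$,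 $u=\max\{i:a_i\ne0\}$: no internal zeros means $a_i\ne0$ for $\ell\le i\le u$; log-concave means $a_i^2\ge a_{i-1}a_{i+1}$ for all $i$; ultra-log-concave means $(a_i/\binom{u-\ell}{i-\ell})_i$ is log-concave. *)

(* Defs.v *)
From mathcomp Require Import all_boot all_order all_algebra.
Set Implicit Arguments. Unset Strict Implicit. Unset Printing Implicit Defensive.
Import Order.TTheory GRing.Theory Num.Theory.
Local Open Scope ring_scope.

Section DeltaMatroids.
Variable E : finType.

Definition symdiff (A B : {set E}) : {set E} := (A :\: B) :|: (B :\: A).

Definition is_delta_matroid (B : {set {set E}}) : Prop :=
  B != set0 /\
  forall B1 B2 x, B1 \in B -> B2 \in B -> x \in symdiff B1 B2 ->
    exists2 y, y \in symdiff B1 B2 & symdiff B1 [set x; y] \in B.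

Definition even_dm (B : {set {set E}}) : Prop :=
  forall B1 B2, B1 \in B -> B2 \in B -> odd #|B1| = odd #|B2|.

Definition twist (B : {set {set E}}) (X : {set E}) : {set {set E}} :=
  [set symdiff I X | I in B].

(* principal minor det A[I]; A[emptyset] has determinant 1 *)
Definition principal_minor (K : fieldType) (A : E -> E -> K) (I : {set E}) : K :=
  \det (\matrix_(i < #|I|, j < #|I|) A (enum_val i) (enum_val j)).

Definition symmetric_mx (K : fieldType) (A : E -> E -> K) : Prop :=
  forall i j, A i j = A j i.

Definition skew_symmetric_mx (K : fieldType) (A : E -> E -> K) : Prop :=
  (forall i j, A i j = - A j i) /\ (forall i, A i i = 0).

Definition DA (K : fieldType) (A : E -> E -> K) : {set {set E}} :=
  [set I : {set E} | principal_minor A I != 0].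

Definition representable_over (K : fieldType) (B : {set {set E}}) : Prop :=
  exists (A : E -> E -> K) (X : {set E}),
    (symmetric_mx A \/ skew_symmetric_mx A) /\ B = twist (DA A) X.

Definition regular_dm (B : {set {set E}}) : Prop :=
  even_dm B /\ forall K : fieldType, representable_over K B.

End DeltaMatroids.

Definition count_c (E : finType) (B : {set {set E}}) (R : {set E}) (t : nat)
    (S : 'I_t -> {set E}) (a : 'I_t -> nat) (i : int) : nat :=
  #|[set p : {set E} * {ffun 'I_t -> {set E}} |
      [&& p.1 \subset R, (#|p.1|%:Z == i),
          [forall j, (p.2 j \subset S j) && (#|p.2 j| == a j)],
          [forall j, [disjoint p.1 & p.2 j]],
          [forall j, forall k, (j != k) ==> [disjoint p.2 j & p.2 k]] &
          (p.1 :|: \bigcup_(j < t) p.2 j) \in B]]|.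

(* sequences indexed by int, with nonnegative rational values *)
Definition no_internal_zeros (s : int -> rat) : Prop :=
  forall i j k : int, i <= j -> j <= k -> s i != 0 -> s k != 0 -> s j != 0.

Definition log_concave (s : int -> rat) : Prop :=
  forall i : int, s (i - 1) * s (i + 1) <= s i ^+ 2.

Definition is_min_support (s : int -> rat) (l : int) : Prop :=
  s l != 0 /\ forall i, s i != 0 -> l <= i.

Definition is_max_support (s : int -> rat) (u : int) : Prop :=
  s u != 0 /\ forall i, s i != 0 -> i <= u.

Definition binomz (n k : int) : nat :=
  if (0 <= k) && (0 <= n) then 'C(`|n|%N, `|k|%N) else 0.

Definition ultra_log_concave (s : int -> rat) : Prop :=
  forall l u, is_min_support s l -> is_max_support s u ->
    log_concave (fun i => s i / (binomz (u - l) (i - l))%:R).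

(* Main.v *)
Require Import Defs.
From mathcomp Require Import all_boot all_order all_fingroup all_algebra all_field.
From mathcomp Require Import ring zify.
Set Implicit Arguments. Unset Strict Implicit. Unset Printing Implicit Defensive.
Import Order.TTheory GRing.Theory Num.Theory.
Local Open Scope ring_scope.

(**
  Take a representation of D over F_3 and lift its entries to {0, 1, -1}; the
  representation over F_2, moved to the same basis by a principal pivot, is the
  reduction of this integer matrix modulo 2.  Hence 2 and 3 divide the same
  principal minors, and pivoting on a pair keeps all entries at most 3 in absolute
  value, so they stay in {0, 1, -1}: all principal minors are 0, 1 or -1.  A
  representation over F_3 may be symmetric instead of skew-symmetric; multiplying
  the lift by i makes it skew-Hermitian as well.  So the basis generating
  polynomial of D is det (diag p + diag q * H) with H skew-Hermitian, and it has no
  zeros with all coordinates in the open right half-plane.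

  Substituting z_e = y + r [e in R] + sum_j s_j [e in S_j] and extracting the
  coefficient of y^0 s^a preserves this property, by Gauss-Lucas in one variable
  and a limiting argument for extreme coefficients.  The result is
  sum_i c_i r^i = r^eps g(r^2).  Its roots are symmetric under r -> -r, hence purely
  imaginary, so g has only real nonpositive roots and Newton's inequalities apply.
*)

(** * Principal minors, Schur complements and pivots *)

Section PrincipalMinors.
Variable n : nat.

(** Keeping every minor at size [n] turns pivots and Schur complements into products of square
    matrices. *)
Definition mixmx (R : Type) (J : {set 'I_n}) (A B : 'M[R]_n) : 'M[R]_n :=
  \matrix_(i, j) if i \in J then A i j else B i j.

(* Rows outside [J] being those of the identity, this is [\det A[J]]. *)
Definition pminor (R : comNzRingType) (A : 'M[R]_n) (J : {set 'I_n}) : R :=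
  \det (mixmx J A 1%:M).

Lemma mixmx_mul (R : pzRingType) J (A B C : 'M[R]_n) :
  mixmx J A B *m C = mixmx J (A *m C) (B *m C).
Proof.
apply/matrixP=> i j; rewrite !mxE; case: ifP => iJ;
  by apply: eq_bigr => k _; rewrite mxE iJ.
Qed.

Lemma map_pminor (R S : comNzRingType) (f : {rmorphism R -> S}) (A : 'M[R]_n) J :
  pminor (map_mx f A) J = f (pminor A J).
Proof.
rewrite /pminor -det_map_mx; congr (\det _); apply/matrixP=> i j.
by rewrite !mxE; case: ifP => // _; rewrite rmorph_nat.
Qed.

Section Ring.
Variable R : comNzRingType.
Implicit Types (A : 'M[R]_n) (J : {set 'I_n}).

Lemma pminor_set0 A : pminor A set0 = 1.
Proof.
rewrite /pminor (_ : mixmx _ _ _ = 1%:M) ?det1 //.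
by apply/matrixP=> i j; rewrite !mxE in_set0.
Qed.

Lemma pminor_moved A J (s : 'S_n) k :
  k \notin J -> s k != k -> \prod_i mixmx J A 1%:M i (s i) = 0.
Proof.
move=> kJ sk; rewrite (bigD1 k) //= !mxE (negPf kJ) eq_sym (negPf sk).
by rewrite mul0r.
Qed.

Lemma pminor_set1 A i : pminor A [set i] = A i i.
Proof.
rewrite /pminor /determinant (bigD1 (1%g : 'S_n)) //= odd_perm1 mul1r.
rewrite [X in _ + X]big1 ?addr0 => [|s s1].
  rewrite (bigD1 i) //= !mxE inE eqxx perm1 big1 ?mulr1 // => k ki.
  by rewrite !mxE inE (negPf ki) perm1 eqxx.
have [k /andP[ki sk]] : exists k, (k != i) && (s k != k).
  apply/existsP; apply: contraR s1; rewrite negb_exists => /forallP H.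
  have fixs k : k != i -> s k = k by move=> ki; have := H k; rewrite ki negbK => /eqP.
  apply/eqP/permP=> k; rewrite perm1; have [->|/fixs//] := eqVneq k i.
  by apply/eqP; apply: contraT => si; have /perm_inj E := fixs _ si; rewrite E eqxx in si.
by rewrite (@pminor_moved _ _ _ k) ?mulr0 // inE.
Qed.

Lemma pminor_set2 A i j :
  i != j -> pminor A [set i; j] = A i i * A j j - A i j * A j i.
Proof.
move=> ij; have ji : j != i by rewrite eq_sym.
have t1 : tperm i j != 1%g.
  by apply: contra ij => /eqP/permP/(_ i); rewrite tpermL perm1 => ->.
rewrite /pminor /determinant (bigD1 (1%g : 'S_n)) //= odd_perm1 mul1r.
rewrite (bigD1 (tperm i j)) //= odd_tperm ij mulN1r.
rewrite [X in _ + (_ + X)]big1 ?addr0 => [|s /andP[s1 st]]; last first.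
  have [k /and3P[ki kj sk]] : exists k, [&& k != i, k != j & s k != k].
    apply/existsP; apply: contraR s1; rewrite negb_exists => /forallP H.
    have fixs k : k != i -> k != j -> s k = k.
      by move=> ki kj; have := H k; rewrite ki kj negbK => /eqP.
    have si : (s i == i) || (s i == j).
      apply: contraT; rewrite negb_or => /andP[si sj].
      by have /perm_inj E := fixs _ si sj; rewrite E eqxx in si.
    have sj : (s j == i) || (s j == j).
      apply: contraT; rewrite negb_or => /andP[sji sj].
      by have /perm_inj E := fixs _ sji sj; rewrite E eqxx in sj.
    case/orP: si => /eqP si.
      have sj' : s j = j.
        by case/orP: sj => /eqP // E; move: ij; rewrite -(inj_eq (@perm_inj _ s)) si E eqxx.
      apply/eqP/permP=> k; rewrite perm1.
      have [->//|ki] := eqVneq k i; have [->//|kj] := eqVneq k j; exact: fixs.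
    have sj' : s j = i.
      by case/orP: sj => /eqP // E; move: ij; rewrite -(inj_eq (@perm_inj _ s)) si E eqxx.
    case/negP: st; apply/eqP/permP=> k.
    have [->|ki] := eqVneq k i; first by rewrite tpermL.
    have [->|kj] := eqVneq k j; first by rewrite tpermR.
    by rewrite fixs // tpermD // eq_sym.
  by rewrite (@pminor_moved _ _ _ k) ?mulr0 // !inE negb_or ki.
congr (_ - _); rewrite (bigD1 i) //= (bigD1 j) //= !mxE !inE !eqxx orbT /=.
  rewrite !perm1 [X in _ * (_ * X)]big1 ?mulr1 // => k /andP[ki kj].
  by rewrite !mxE !inE (negPf ki) (negPf kj) /= perm1 eqxx.
rewrite tpermL tpermR [X in _ * (_ * X)]big1 ?mulr1 // => k /andP[ki kj].
by rewrite !mxE !inE (negPf ki) (negPf kj) /= tpermD ?eqxx // eq_sym.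
Qed.

(** The Schur complement of the block on [{i, j}], when the diagonal vanishes there,
    [A j i = e * A i j], and [e] and [A i j] are their own inverses. *)
Definition schur (e : R) A i j : 'M[R]_n :=
  \matrix_(k, l) (A k l - e * A i j * A k i * A j l - A i j * A k j * A i l).

(** Determinants are multiplicative over Schur complements, and [- e] is the minor on [{i, j}]. The
    mixed matrix factors through [U] (elimination), the complement, and [V] (rows [i] and [j] of
    [A]). *)
Lemma pminor_schur (e : R) A i j J :
  i != j -> i \notin J -> j \notin J -> A i i = 0 -> A j j = 0 ->
  e * e = 1 -> A j i = e * A i j -> A i j * A i j = 1 ->
  pminor A (i |: (j |: J)) = - e * pminor (schur e A i j) J.
Proof.
move=> ij iJ jJ Aii Ajj ee Aji aa.
set A' := schur e A i j; set a := A i j in aa Aji *.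
have ji : j != i by rewrite eq_sym.
have A'i k : A' k i = 0.
  rewrite mxE Aii mulr0 subr0 Aji -/a.
  by transitivity (A k i * (1 - (e * e) * (a * a))); [ring | rewrite ee aa mulr1 subrr mulr0].
have A'j k : A' k j = 0.
  rewrite mxE Ajj mulr0 subr0 -/a.
  by transitivity (A k j * (1 - a * a)); [ring | rewrite aa subrr mulr0].
pose V := mixmx [set i; j] A 1%:M.
have A'V : A' *m V = A'.
  rewrite -[RHS]mulmx1; apply/matrixP=> k l; rewrite !mxE; apply: eq_bigr => m _.
  rewrite [V _ _]mxE !inE; have [->|mi] := eqVneq m i; first by rewrite A'i !mul0r.
  by have [->|mj] := eqVneq m j; rewrite ?A'j ?mul0r.
(* [c1] and [c2] are the columns of [A[J, ij] A[ij]^-1]: [U] adds back to the rows in [J] the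
   multiples of rows [i] and [j] that elimination removed. *)
pose c1 : 'cV[R]_n := \col_k (if k \in J then a * A k j else 0).
pose c2 : 'cV[R]_n := \col_k (if k \in J then e * a * A k i else 0).
pose U := 1%:M + c1 *m delta_mx 0 i + c2 *m delta_mx 0 j.
have UE k l : U k l = (k == l)%:R + c1 k 0 * (l == i)%:R + c2 k 0 * (l == j)%:R.
  by rewrite !mxE !big_ord1 !mxE !eqxx.
(* The transpose of [U] differs from the identity only in rows [i] and [j], so a 2 x 2 minor
   decides. *)
have dU : \det U = 1.
  rewrite -det_tr (_ : U^T = mixmx [set i; j] U^T 1%:M).
    rewrite -/(pminor _ _) pminor_set2 // ![U^T _ _]mxE !UE !mxE !eqxx.
    by rewrite (negPf iJ) (negPf jJ) (negPf ij) (negPf ji) !mul0r !addr0 mulr1 mulr0 subr0.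
  apply/matrixP=> k l; rewrite [RHS]mxE; case: ifP => //; rewrite !inE => /negbT.
  rewrite negb_or => /andP[/negPf ki /negPf kj]; rewrite [LHS]mxE UE [RHS]mxE ki kj.
  by rewrite !mulr0 !addr0 eq_sym.
have dV : \det V = - e.
  rewrite -/(pminor _ _) pminor_set2 // Aii Aji mul0r sub0r -/a.
  by transitivity (- e * (a * a)); [ring | rewrite aa mulr1].
have -> : pminor A (i |: (j |: J)) = \det (U *m (mixmx J A' 1%:M *m V)).
  congr (\det _); rewrite mixmx_mul mul1mx A'V !mulmxDl mul1mx -!mulmxA -!rowE.
  apply/matrixP=> k l; rewrite !mxE !big_ord1 !mxE !inE !eqxx (negPf iJ) (negPf jJ) /= orbT.
  have [->|ki] := eqVneq k i; first by rewrite (negPf iJ) /=; ring.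
  have [->|kj] := eqVneq k j; first by rewrite (negPf jJ) /=; ring.
  by rewrite /=; case: ifP => kJ; rewrite -?/a; ring.
by rewrite !det_mulmx dU dV mul1r mulrC.
Qed.

End Ring.

(** [N *m invmx M] is the principal pivot transform: choosing rows of [N] on [Z] and of [M] off [Z]
    yields rows of [A] exactly on [symdiff Z Y]. It is congruent to [M^T *m N], which is
    skew-symmetric. *)
Lemma pminor_pivot (F : fieldType) (A : 'M[F]_n) (Y : {set 'I_n}) :
  A^T = - A -> pminor A Y != 0 ->
  exists A' : 'M[F]_n, A'^T = - A' /\
    forall Z, pminor A' Z * pminor A Y = pminor A (symdiff Z Y).
Proof.
move=> Ask AY; pose M := mixmx Y A 1%:M; pose N := mixmx Y 1%:M A.
have uM : M \in unitmx by rewrite unitmxE unitfE.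
have Akl k l : A l k = - A k l by move/matrixP/(_ k l): Ask; rewrite !mxE.
have MN : (M^T *m N)^T = - (M^T *m N).
  have E k l : (M^T *m N) k l = A k l * ((k \notin Y)%:R - (l \in Y)%:R).
    rewrite mxE (bigID (mem Y)) /=.
    rewrite [X in _ + X](eq_bigr (fun m => (m == k)%:R * A m l)); last first.
      by move=> m mY; rewrite !mxE (negPf mY).
    rewrite [X in X + _](eq_bigr (fun m => A m k * (m == l)%:R)); last first.
      by move=> m mY; rewrite !mxE mY.
    rewrite (big_mkcond (fun m => m \in Y)) (big_mkcond (fun m => m \notin Y)).
    rewrite (bigD1 l) //= eqxx big1 => [|m /negPf->]; last by rewrite mulr0 if_same.
    rewrite (bigD1 k) //= eqxx big1 => [|m /negPf->]; last by rewrite mul0r if_same.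
    by rewrite (Akl k l); case: (l \in Y); case: (k \in Y) => /=; ring.
  apply/matrixP=> k l; rewrite mxE [RHS]mxE !E.
  rewrite (Akl k l).
  by case: (l \in Y); case: (k \in Y) => /=; ring.
exists (N *m invmx M); split.
  have -> : N *m invmx M = (invmx M)^T *m (M^T *m N) *m invmx M.
    by rewrite trmx_inv mulmxA mulVmx ?unitmx_tr // mul1mx.
  by rewrite !trmx_mul -trmx_mul MN trmxK mulNmx mulmxN mulmxA.
move=> Z; rewrite /pminor -det_mulmx mixmx_mul mul1mx mulmxKV //.
congr (\det _); apply/matrixP=> k l; rewrite !mxE !inE.
by case: (k \in Z); case: (k \in Y).
Qed.

End PrincipalMinors.

(** * Integer matrices with all principal minors 0, 1 or -1 *)

Lemma small_of_dvd23 (v : int) :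
  `|v| <= 3 -> (2 %| v)%Z = (3 %| v)%Z -> `|v| <= 1.
Proof. by case: v => [[|[|[|[|k]]]]|[|[|[|k]]]]. Qed.

Section Unimodularity.
Variables (n : nat) (e : int).
Hypothesis e1 : e = 1 \/ e = -1.

(** The last clause is all that is retained of the two finite-field representations; it is inherited
    by Schur complements. *)
Definition unimodular_like (A : 'M[int]_n) : Prop :=
  [/\ forall i j, A j i = e * A i j, forall i, A i i = 0,
      forall i j, `|A i j| <= 1 &
      forall J, (2 %| pminor A J)%Z = (3 %| pminor A J)%Z].

(** Minors of the complement are, up to sign, minors of [A], so 2 and 3 still divide the same ones.
    The minor on [{k, l}] is [- e] times the square of an entry; hence 2 and 3 divide the same
    entries, and these are at most 3 in absolute value. *)
Lemma schur_unimodular_like A i j :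
  unimodular_like A -> A i j != 0 -> unimodular_like (schur e A i j).
Proof.
case=> Asym A0 A1 A23 aN0.
have ee : e * e = 1 by case: e1 => ->.
have aa : A i j * A i j = 1.
  by have := A1 i j; move: aN0; case: (A i j) => [[|[|k]]|[|k]].
have ij : i != j by apply: contraNneq aN0 => ->; rewrite A0.
have dvde d x : (d %| - e * x)%Z = (d %| x)%Z.
  by case: e1 => ->; rewrite ?opprK ?mul1r ?mulN1r !dvdzE ?abszN.
set A' := schur e A i j.
have A's k l : A' l k = e * A' k l.
  rewrite !mxE (Asym k l) (Asym i l) (Asym j l) (Asym k i) (Asym k j).
  by case: e1 => ->; ring.
have A'i l : A' i l = 0.
  rewrite mxE A0; transitivity (A i l * (1 - A i j * A i j)); first by ring.
  by rewrite aa subrr mulr0.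
have A'j l : A' j l = 0.
  rewrite mxE A0 (Asym i j).
  transitivity (A j l * (1 - (e * e) * (A i j * A i j))); first by ring.
  by rewrite ee aa subrr mulr0.
(* Rows [i] and [j] of [A'] vanish, so only sets avoiding both need [pminor_schur]. *)
have A'23 J : (2 %| pminor A' J)%Z = (3 %| pminor A' J)%Z.
  have P0 k : k \in J -> (forall l, A' k l = 0) -> pminor A' J = 0.
    move=> kJ k0; rewrite /pminor (expand_det_row _ k) big1 // => l _.
    by rewrite mxE kJ k0 mul0r.
  have [/P0-> //|iJ] := boolP (i \in J); have [/P0-> //|jJ] := boolP (j \in J).
  by have := A23 (i |: (j |: J)); rewrite (@pminor_schur _ _ e _ _ _ _ ij) // ?A0 // !dvde.
have A'3 k l : `|A' k l| <= 3.
  rewrite mxE; have := A1 k l; have := A1 i j; have := A1 k i; have := A1 j l.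
  have := A1 k j; have := A1 i l.
  have M x y : `|x| <= 1 -> `|y| <= 1 -> `|x * y| <= 1 :> int.
    by move=> x1 y1; rewrite normrM mulr_ile1.
  move=> il kj jl ki a1 kl.
  apply: le_trans (ler_normB _ _) _; rewrite (_ : 3 = 2 + 1) // lerD //.
    apply: le_trans (ler_normB _ _) _; rewrite (_ : 2 = 1 + 1) // lerD //.
    by rewrite !M //; case: e1 => ->.
  by rewrite !M.
(* For [e = -1] the two products cancel; for [e = 1] they agree, so the entry is even, hence a
   multiple of 3 as well, and too small to be nonzero. *)
have A'0 k : A' k k = 0.
  have d2 : (2 %| A' k k)%Z.
    rewrite mxE A0 (Asym k j) (Asym k i).
    case: e1 => ->; last by rewrite (_ : _ - _ = 0) //; ring.
    by apply/dvdzP; exists (- A i j * A k i * A k j); ring.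
  have := A'23 [set k]; rewrite pminor_set1 d2 => /esym; move: d2 (A'3 k k).
  by case: (A' k k) => [[|[|[|[|m]]]]|[|[|[|m]]]].
split=> // k l; apply: small_of_dvd23 => //.
have [->|kl] := eqVneq k l; first by rewrite A'0.
have := A'23 [set k; l]; rewrite pminor_set2 // !A'0 mul0r sub0r (A's k l).
have -> : - (A' k l * (e * A' k l)) = - e * (A' k l * A' k l) by ring.
rewrite !dvde; case: (A' k l) (A'3 k l) => [[|[|[|[|m]]]]|[|[|[|m]]]] //.
Qed.

(** Pivoting on a nonzero entry inside [J] removes two indices at the cost of a factor [- e].
    Without such an entry the block is zero. *)
Lemma unimodular_like_pminor A J : unimodular_like A ->
  pminor A J = 0 \/ ~~ odd #|J| /\ pminor A J = (- e) ^+ #|J|./2.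
Proof.
have [m] := ubnP #|J|; elim: m => // m IH in A J * => Jm HA.
have [Asym A0 A1 _] := HA.
have [->|/set0Pn[k kJ]] := eqVneq J set0.
  by right; rewrite cards0 pminor_set0.
have [[i [j [iJ jJ aN0]]]|noedge] :
    (exists i j, [/\ i \in J, j \in J & A i j != 0]) \/
    (forall i j, i \in J -> j \in J -> A i j = 0).
- have [/existsP[i /existsP[j /and3P[iJ jJ aN0]]]|/existsPn H] :=
    boolP [exists i, exists j, [&& i \in J, j \in J & A i j != 0]].
    by left; exists i, j.
  right=> i j iJ jJ; have /existsPn/(_ j) := H i.
  by rewrite iJ jJ negbK => /eqP.
- have ij : i != j by apply: contraNneq aN0 => ->; rewrite A0.
  pose J' := J :\ i :\ j.
  have iJ' : i \notin J' by rewrite !inE eqxx andbF.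
  have jJ' : j \notin J' by rewrite !inE eqxx.
  have JE : J = i |: (j |: J').
    by rewrite setD1K ?setD1K // !inE eq_sym ij.
  have cJ : #|J| = #|J'|.+2.
    by rewrite JE cardsU1 in_setU1 negb_or ij iJ' cardsU1 jJ'.
  have aa : A i j * A i j = 1.
    by have := A1 i j; move: aN0; case: (A i j) => [[|[|l]]|[|l]].
  have -> : pminor A J = - e * pminor (schur e A i j) J'.
    by rewrite {1}JE (@pminor_schur _ _ e _ _ _ _ ij) // ?A0 //; case: e1 => ->.
  have [||->|[oJ ->]] := IH (schur e A i j) J'.
  + by move: Jm; rewrite cJ ltnS => /ltnW.
  + exact: schur_unimodular_like.
  + by left; rewrite mulr0.
  + by right; rewrite cJ /= negbK oJ exprS.
left; rewrite /pminor (expand_det_col _ k) big1 // => l _; rewrite mxE.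
case: ifP => lJ; first by rewrite noedge // mul0r.
by rewrite mxE (_ : (l == k) = false) ?mul0r //; apply: contraFF lJ => /eqP->.
Qed.

End Unimodularity.

(** * Lifting a ternary matrix to the integers *)

Lemma pminorZ (n : nat) (R : comNzRingType) (c : R) (A : 'M[R]_n) J :
  pminor (c *: A) J = c ^+ #|J| * pminor A J.
Proof.
have -> : c ^+ #|J| = \det (diag_mx (\row_i (if i \in J then c else 1))).
  rewrite det_diag -prodr_const big_mkcond /=.
  by apply: eq_bigr => i _; rewrite mxE.
rewrite -det_mulmx mul_diag_mx; congr (\det _).
by apply/matrixP=> i j; rewrite !mxE; case: ifP => // _; rewrite mul1r.
Qed.

Definition lift_F3 (x : 'F_3) : int :=
  if x == 0 then 0 else if x == 1 then 1 else -1.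

Lemma lift_F3K (x : 'F_3) : (lift_F3 x)%:~R = x.
Proof. by case: x => [[|[|[|k]]] kx] //; apply: val_inj. Qed.

Lemma lift_F3N (x : 'F_3) : lift_F3 (- x) = - lift_F3 x.
Proof. by case: x => [[|[|[|k]]] kx]. Qed.

Lemma lift_F3_norm (x : 'F_3) : `|lift_F3 x| <= 1.
Proof. by case: x => [[|[|[|k]]] kx]. Qed.

Lemma lift_F3_F2 (x : 'F_3) : (lift_F3 x)%:~R = (x != 0)%:R :> 'F_2.
Proof. by case: x => [[|[|[|k]]] kx] //; apply: val_inj. Qed.

Lemma eq_F2 (x : 'F_2) : x = (x != 0)%:R.
Proof. by case: x => [[|[|k]] kx] //; apply: val_inj. Qed.

Lemma unimodular_lift n (A2 : 'M['F_2]_n) (A3 : 'M['F_3]_n) :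
  A2^T = - A2 -> A3^T = A3 \/ A3^T = - A3 ->
  (forall i, A2 i i = 0) -> (forall i, A3 i i = 0) ->
  (forall J, (pminor A2 J != 0) = (pminor A3 J != 0)) ->
  exists (e : int) (A : 'M[int]_n), [/\ e = 1 \/ e = -1, unimodular_like e A &
    forall J, (pminor A J != 0) = (pminor A3 J != 0)].
Proof.
move=> sk2 sym3 d2 d3 eq23.
have [e e1 A3s] : exists2 e : int, e = 1 \/ e = -1 &
    forall i j, A3 j i = e%:~R * A3 i j.
  case: sym3 => /matrixP E; [exists 1|exists (-1)]; try by [left|right].
    by move=> i j; have := E i j; rewrite mxE mul1r.
  by move=> i j; have := E i j; rewrite !mxE => ->; rewrite mulN1r.
have A2s i j : A2 j i = - A2 i j by move/matrixP/(_ i j): sk2; rewrite !mxE.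
pose A := map_mx lift_F3 A3.
have map3 : map_mx intr A = A3 by apply/matrixP=> i j; rewrite !mxE lift_F3K.
(* With zero diagonals, the minor on [{i, j}] is a square up to sign, so [A2] and [A3] have the same
   support; over F_2 the support is the whole matrix. *)
have map2 : map_mx intr A = A2.
  apply/matrixP=> i j; rewrite !mxE lift_F3_F2 [RHS]eq_F2; congr (_%:R); congr nat_of_bool.
  have [->|ij] := eqVneq i j; first by rewrite d2 d3.
  have := eq23 [set i; j]; rewrite !pminor_set2 // !d2 !d3 !mul0r !sub0r !oppr_eq0.
  rewrite (A2s i j) (A3s i j) !mulf_eq0 oppr_eq0 orbb => ->.
  by case: e1 => ->; rewrite ?oppr_eq0 orbb.
have dvd p (A' : 'M['F_p]_n) J : prime p -> map_mx intr A = A' ->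
    (p %| pminor A J)%Z = (pminor A' J == 0).
  by move=> pp <-; rewrite map_pminor (dvdz_pcharf (pchar_Fp pp)).
have dvd2 J : (2 %| pminor A J)%Z = (pminor A2 J == 0) by exact: dvd.
have dvd3 J : (3 %| pminor A J)%Z = (pminor A3 J == 0) by exact: dvd.
have UA : unimodular_like e A.
  split=> [i j|i|i j|J]; rewrite ?mxE ?lift_F3_norm //.
  - by rewrite (A3s i j); case: e1 => ->; rewrite ?mul1r // !mulN1r lift_F3N.
  - by rewrite d3.
  - by rewrite dvd2 dvd3; apply: negb_inj.
exists e, A; split=> // J; rewrite -dvd3.
(* A nonzero minor of [A] is a unit, so it survives reduction modulo 3. *)
have [->|[_ ->]] := unimodular_like_pminor e1 J UA; first by rewrite eqxx dvdz0.
by case: e1 => ->; rewrite ?opprK ?expr1n // dvdzE abszX exp1n expf_eq0 andbF.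
Qed.

(** * From a regular Delta-matroid to a skew-Hermitian matrix *)

Section Representation.
Variable E : finType.
Implicit Types (B : {set {set E}}) (I X Y : {set E}).
Local Notation n := #|E|.

Definition rankset I : {set 'I_n} := [set i | enum_val i \in I].

Lemma rankset_bij : bijective rankset.
Proof.
pose r (J : {set 'I_n}) : {set E} := [set e | enum_rank e \in J].
by exists r => I; apply/setP=> e; rewrite !inE ?enum_rankK ?enum_valK.
Qed.

Lemma card_rankset I : #|rankset I| = #|I|.
Proof.
rewrite -(card_imset _ enum_val_inj); apply: eq_card => e.
apply/imsetP/idP => [[i]|eI]; first by rewrite inE => ? ->.
by exists (enum_rank e); rewrite ?inE enum_rankK.
Qed.

Lemma rankset_symdiff I X : rankset (symdiff I X) = symdiff (rankset I) (rankset X).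
Proof. by apply/setP=> i; rewrite !inE. Qed.

Lemma in_symdiff I X e : (e \in symdiff I X) = (e \in I) (+) (e \in X).
Proof. by rewrite !inE; case: (e \in I); case: (e \in X). Qed.

Lemma symdiffA I X Y : symdiff I (symdiff X Y) = symdiff (symdiff I X) Y.
Proof. by apply/setP=> e; rewrite !in_symdiff addbA. Qed.

Lemma symdiff0 I : symdiff set0 I = I.
Proof. by apply/setP=> e; rewrite in_symdiff inE. Qed.

Lemma symdiffK X : involutive (fun I => symdiff I X).
Proof. by move=> I; apply/setP=> e; rewrite !in_symdiff addbK. Qed.

Lemma mem_twist B X I : (I \in twist B X) = (symdiff I X \in B).
Proof.
by rewrite -{1}(symdiffK X I) (mem_imset _ _ (inv_inj (symdiffK X))).
Qed.

Lemma odd_symdiff I X : odd #|symdiff I X| = odd #|I| (+) odd #|X|.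
Proof.
have dis : (I :\: X) :&: (X :\: I) = set0.
  by apply/setP=> e; rewrite !inE; case: (e \in I); case: (e \in X).
rewrite cardsU dis cards0 subn0 oddD.
rewrite -(cardsID X I) -(cardsID I X) (setIC X I) !oddD.
by case: (odd _); case: (odd _); case: (odd _).
Qed.

Section Kernel.
Variables (K : fieldType) (A : E -> E -> K).

Definition emx : 'M[K]_n := \matrix_(i, j) A (enum_val i) (enum_val j).

(** [principal_minor] has size [#|I|] and [pminor] size [#|E|]; only their vanishing is compared,
    through this left kernel condition free of matrix indices. *)
Definition has_kernel I := exists w : E -> K,
  (exists2 e, e \in I & w e != 0) /\
  forall f, f \in I -> \sum_(e in I) w e * A e f = 0.

Lemma principal_minor_kernel I : principal_minor A I = 0 <-> has_kernel I.
Proof.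
split=> [/eqP/det0P[v v0 vA]|[w [[e eI we] wA]]].
- pose w e := \sum_k (enum_val k == e)%:R * v 0 k.
  have wE k : w (enum_val k) = v 0 k.
    rewrite /w (bigD1 k) //= eqxx mul1r big1 ?addr0 // => l lk.
    by rewrite (inj_eq enum_val_inj) (negPf lk) mul0r.
  exists w; split.
    have /existsP[k vk] : [exists k, v 0 k != 0].
      apply: contraNT v0 => /existsPn H; apply/eqP/rowP=> k; rewrite mxE.
      by have := H k; rewrite negbK => /eqP.
    by exists (enum_val k); [exact: enum_valP | rewrite wE].
  move=> f fI; rewrite big_enum_val /=.
  have /rowP/(_ (enum_rank_in fI f)) := vA; rewrite !mxE => {2}<-.
  by apply: eq_bigr => k _; rewrite mxE wE enum_rankK_in.
- apply/eqP/det0P; exists (\row_k w (enum_val k)).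
    apply: contraNneq we => /rowP/(_ (enum_rank_in eI e)).
    by rewrite !mxE enum_rankK_in // => ->.
  apply/rowP=> l; have := wA _ (enum_valP l); rewrite big_enum_val /= !mxE => wl.
  by rewrite -[RHS]wl; apply: eq_bigr => k _; rewrite !mxE.
Qed.

Lemma pminor_kernel I : pminor emx (rankset I) = 0 <-> has_kernel I.
Proof.
split=> [/eqP/det0P[v v0 vA]|[w [[e eI we] wA]]].
- have vE f : \sum_(e in I) v 0 (enum_rank e) * A e f
      + (if f \in I then 0 else v 0 (enum_rank f)) = 0.
    have /rowP/(_ (enum_rank f)) := vA; rewrite !mxE => vf.
    rewrite -[RHS]vf (reindex (@enum_rank E)) /=; last exact: onW_bij (enum_rank_bij E).
    rewrite [RHS](bigID (mem I)) /=; congr (_ + _).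
      by apply: eq_bigr => e eI; rewrite !mxE inE enum_rankK eI enum_rankK.
    rewrite big_mkcond (bigD1 f) //= [X in _ + X]big1 ?addr0 => [|e ef].
      by case: ifP => fI //=; rewrite !mxE inE enum_rankK fI eqxx mulr1.
    case: ifP => // eI; rewrite !mxE inE enum_rankK (negPf eI).
    by rewrite (inj_eq enum_rank_inj) (negPf ef) mulr0.
  exists (fun e => v 0 (enum_rank e)); split; last first.
    by move=> f fI; have := vE f; rewrite fI addr0.
  apply/exists_inP; apply: contraNT v0; rewrite negb_exists_in => /forall_inP vI.
  have {}vI e : e \in I -> v 0 (enum_rank e) = 0.
    by move/vI; rewrite negbK => /eqP.
  apply/eqP/rowP=> k; rewrite mxE -(enum_valK k); have [/vI//|kI] := boolP (enum_val k \in I).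
  have := vE (enum_val k); rewrite (negPf kI) big1 ?add0r // => e /vI ->.
  by rewrite mul0r.
- apply/eqP/det0P.
  (* Outside [I] the identity rows force the value that cancels column [f]. *)
  pose v f := if f \in I then w f else - \sum_(e in I) w e * A e f.
  exists (\row_k v (enum_val k)).
    by apply: contraNneq we => /rowP/(_ (enum_rank e)); rewrite !mxE enum_rankK /v eI => ->.
  apply/rowP=> l; rewrite !mxE (reindex (@enum_rank E)) /=; last exact: onW_bij (enum_rank_bij E).
  rewrite (bigID (mem I)) /=.
  rewrite (eq_bigr (fun e => w e * A e (enum_val l))); last first.
    by move=> f fI; rewrite !mxE inE !enum_rankK /v fI.
  rewrite [X in _ + X]big_mkcond [X in _ + X](bigD1 (enum_val l)) //= [X in _ + (_ + X)]big1 ?addr0.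
    have [lI|lI] /= := boolP (enum_val l \in I); first by rewrite wA // addr0.
    by rewrite !mxE inE !enum_rankK /v (negPf lI) enum_valK eqxx mulr1 subrr.
  move=> f fl; case: ifP => // fI; rewrite !mxE inE enum_rankK (negPf fI).
  by rewrite -(enum_valK l) (inj_eq enum_rank_inj) (negPf fl) mulr0.
Qed.

Lemma mem_DA I : (I \in DA A) = (pminor emx (rankset I) != 0).
Proof.
rewrite inE; congr (~~ _); apply/eqP/eqP.
  by move=> /principal_minor_kernel/pminor_kernel.
by move=> /pminor_kernel/principal_minor_kernel.
Qed.
End Kernel.

Lemma representable_mx (K : fieldType) B : representable_over K B ->
  exists (A : 'M[K]_n) X, (A^T = A \/ A^T = - A) /\
    forall I, (pminor A (rankset I) != 0) = (symdiff I X \in B).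
Proof.
move=> [A [X [Asym ->]]]; exists (emx A), X; split.
  by case: Asym => [As|[As _]]; [left|right]; apply/matrixP=> i j; rewrite !mxE As.
by move=> I; rewrite mem_twist symdiffK mem_DA.
Qed.

(** The empty minor is 1, so [X] is a basis; a nonzero diagonal entry would give a basis differing
    from [X] in one element. *)
Lemma diag_even_mx (K : fieldType) B X (A : 'M[K]_n) : even_dm B ->
  (forall I, (pminor A (rankset I) != 0) = (symdiff I X \in B)) ->
  forall i, A i i = 0.
Proof.
move=> evB AB i; apply/eqP; rewrite -pminor_set1; apply: contraT => Ai.
have Ei : [set i] = rankset [set enum_val i].
  by apply/setP=> j; rewrite !inE (inj_eq enum_val_inj).
have E0 : rankset set0 = set0 by apply/setP=> j; rewrite !inE.
have XB : symdiff set0 X \in B by rewrite -AB E0 pminor_set0 oner_eq0.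
move: Ai; rewrite Ei AB => /evB/(_ XB).
by rewrite !odd_symdiff cards1 cards0; case: (odd #|X|).
Qed.

Lemma regular_skew_hermitian (C : numClosedFieldType) B : regular_dm B ->
  exists (H : 'M[C]_n) X, (forall i j, (H j i)^* = - H i j) /\
    forall I, pminor H (rankset I) = (symdiff I X \in B)%:R.
Proof.
move=> [evB rep].
have [A2 [X2 [sym2 AB2]]] := representable_mx (rep 'F_2).
have [A3 [X3 [sym3 AB3]]] := representable_mx (rep 'F_3).
have {}sym2 : A2^T = - A2.
  case: sym2 => -> //; apply/matrixP=> i j; rewrite mxE.
  by case: (A2 i j) => [[|[|k]] kx] //; apply: val_inj.
have R0 : rankset set0 = set0 by apply/setP=> j; rewrite !inE.
have X3B : X3 \in B by rewrite -(symdiff0 X3) -AB3 R0 pminor_set0 oner_eq0.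
(* As [X3] is a basis, the binary matrix can be pivoted on [symdiff X3 X2], which moves its twist
   from [X2] to [X3]. *)
have Y0 : pminor A2 (rankset (symdiff X3 X2)) != 0 by rewrite AB2 symdiffK.
have [A2' [sk2 A2P]] := pminor_pivot sym2 Y0.
have AB2' I : (pminor A2' (rankset I) != 0) = (symdiff I X3 \in B).
  have /(congr1 (fun x => x != 0)) := A2P (rankset I).
  rewrite mulf_eq0 (negPf Y0) orbF -rankset_symdiff AB2 => ->.
  by rewrite symdiffA symdiffK.
have eq23 J : (pminor A2' J != 0) = (pminor A3 J != 0).
  have [r _ rK] := rankset_bij; by rewrite -(rK J) AB2' AB3.
have [e [A [e1 UA A3E]]] :=
  unimodular_lift sk2 sym3 (diag_even_mx evB AB2') (diag_even_mx evB AB3) eq23.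
have [As _ _ _] := UA.
have PE I : pminor A (rankset I) = (symdiff I X3 \in B)%:R * (- e) ^+ #|I|./2
    /\ (symdiff I X3 \in B -> ~~ odd #|I|).
  rewrite -AB3 -A3E; have [->|[oI ->]] := unimodular_like_pminor e1 (rankset I) UA.
    by rewrite eqxx mul0r.
  rewrite card_rankset in oI *; split=> //.
  by rewrite expf_eq0 oppr_eq0; case: e1 => ->; rewrite andbF mul1r.
case: e1 => e1; rewrite {e}e1 in As UA PE.
(* In the symmetric case nonzero minors are [(-1) ^+ #|I|./2]; scaling by ['i] multiplies them by
   the same sign, [#|I|] being even. *)
- exists ('i *: map_mx intr A), X3; split=> [i j|I].
    rewrite !mxE rmorphM /= conjCi (As i j) mul1r mulNr.
    by rewrite rmorph_int.
  rewrite pminorZ map_pminor card_rankset; case: (PE I) => ->.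
  case: (_ \in B) => [/(_ isT) oI|_]; last by rewrite mul0r mulr0.
  rewrite mul1r rmorphXn rmorphN rmorph1 -{1}(even_halfK oI) -mul2n exprM sqrCi.
  by rewrite -exprMn mulrNN mulr1 expr1n.
- exists (map_mx intr A), X3; split=> [i j|I].
    rewrite !mxE (As i j) mulN1r rmorphN /= rmorphN /=.
    by rewrite rmorph_int.
  rewrite map_pminor; case: (PE I) => -> _.
  by rewrite opprK expr1n mulr1 rmorph_nat.
Qed.

End Representation.

(** * The half-plane property of the basis generating polynomial *)

Section BasisStability.
Variable C : numClosedFieldType.

(** Pairing a kernel vector [v] with its conjugate equates [\sum_i p i / q i * |v i|^2], of positive
    real part, with minus the value of a skew-Hermitian form, which is purely imaginary. *)
Lemma det_dissipative_neq0 n (H : 'M[C]_n) (p q : 'I_n -> C) :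
  (forall i j, (H j i)^* = - H i j) -> (forall i, q i != 0) ->
  (forall i, 0 < 'Re (p i / q i)) ->
  \det (\matrix_(i, j) (q i * H i j + p i * (i == j)%:R)) != 0.
Proof.
move=> Hsk q0 pq; rewrite -det_tr; apply/det0P=> -[v v0 vA].
have vE i : p i / q i * v 0 i = - \sum_j H i j * v 0 j.
  apply: (mulfI (q0 i)); rewrite mulrA mulrCA divff // mulr1 mulrN mulr_sumr.
  have /rowP/(_ i) := vA; rewrite !mxE.
  under eq_bigr do rewrite !mxE mulrDr.
  rewrite big_split /= [X in _ + X](bigD1 i) //= eqxx [X in _ + (_ + X)]big1 => [|j ji]; last first.
    by rewrite eq_sym (negPf ji) !mulr0.
  rewrite mulr1 addr0 addrC [v 0 i * _]mulrC => /eqP; rewrite addr_eq0 => /eqP ->.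
  by congr (- _); apply: eq_bigr => j _; rewrite mulrC mulrA.
pose S := \sum_i \sum_j (v 0 i)^* * H i j * v 0 j.
have SE : S = - \sum_i p i / q i * `|v 0 i| ^+ 2.
  rewrite -sumrN; apply: eq_bigr => i _; rewrite normCK mulrA vE mulNr opprK.
  by rewrite mulr_suml; apply: eq_bigr => j _; ring.
have Sconj : S^* = - S.
  rewrite rmorph_sum /= /S exchange_big /= -sumrN; apply: eq_bigr => i _.
  rewrite rmorph_sum /= -sumrN; apply: eq_bigr => j _.
  by rewrite !rmorphM /= conjCK Hsk; ring.
have ReS : 'Re S = 0 by rewrite ReE Sconj subrr mul0r.
have : 0 < 'Re (- S).
  rewrite SE opprK raddf_sum /=.
  have [k vk] : exists k, v 0 k != 0.
    apply/existsP; apply: contraNT v0 => /existsPn V; apply/eqP/rowP=> k.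
    by rewrite mxE; have := V k; rewrite negbK => /eqP.
  have nn i : 'Re (p i / q i * `|v 0 i| ^+ 2) = 'Re (p i / q i) * `|v 0 i| ^+ 2.
    by rewrite ReMr // realX // normr_real.
  rewrite (bigD1 k) //= nn ltr_wpDr // ?mulr_gt0 ?exprn_gt0 ?normr_gt0 //.
  by apply: sumr_ge0 => i _; rewrite nn mulr_ge0 ?exprn_ge0 // ltW.
by rewrite raddfN /= ReS oppr0 ltxx.
Qed.

(** Multilinearity in the rows: each row comes from [q * H] or from the diagonal. *)
Lemma det_diagD_pminor n (H : 'M[C]_n) (p q : 'I_n -> C) :
  \det (\matrix_(i, j) (q i * H i j + p i * (i == j)%:R)) =
  \sum_(J : {set 'I_n}) (\prod_i (if i \in J then q i else p i)) * pminor H J.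
Proof.
rewrite /determinant.
under eq_bigr => s _.
  under eq_bigr do rewrite mxE.
  rewrite bigA_distr big_distrr /=; over.
rewrite exchange_big /=; apply: eq_bigr => J _; rewrite /pminor big_distrr /=.
apply: eq_bigr => s _; rewrite mulrCA; congr (_ * _); rewrite -big_split /=.
by apply: eq_bigr => i _; rewrite !mxE; case: ifP.
Qed.

Lemma Re_inv_gt0 (z : C) : 0 < 'Re z -> 0 < 'Re z^-1.
Proof.
move=> z0; rewrite ReV divr_gt0 // exprn_gt0 // normr_gt0.
by apply: contraTneq z0 => ->; rewrite raddf0 ltxx.
Qed.

Lemma Re_gt0_neq0 (z : C) : 0 < 'Re z -> z != 0.
Proof. by apply: contraTneq => ->; rewrite raddf0 ltxx. Qed.

Lemma basis_sum_neq0 (E : finType) (B : {set {set E}}) (z : E -> C) :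
  regular_dm B -> (forall e, 0 < 'Re (z e)) ->
  \sum_(I in B) \prod_(e in I) z e != 0.
Proof.
move=> /(regular_skew_hermitian C)[H [X [Hsk HB]]] z0.
(* Exchanging [p] and [q] on [X] absorbs the twist: the factor [z] appears exactly on [symdiff J X].
   The ratio [p / q] is [z] or its inverse, both in the half-plane. *)
pose p (i : 'I_#|E|) := if enum_val i \in X then z (enum_val i) else 1.
pose q (i : 'I_#|E|) := if enum_val i \in X then 1 else z (enum_val i).
have <- : \sum_(J : {set 'I_#|E|}) (\prod_i (if i \in J then q i else p i)) * pminor H J =
    \sum_(I in B) \prod_(e in I) z e.
  rewrite (reindex (@rankset E)) /=; last exact: onW_bij (rankset_bij E).
  rewrite [RHS](reindex_inj (inv_inj (symdiffK X))) /= [RHS]big_mkcond /=.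
  apply: eq_bigr => I _; rewrite HB; case: ifP => _; last by rewrite mulr0.
  rewrite mulr1 (reindex (@enum_rank E)) /=; last exact: onW_bij (enum_rank_bij E).
  rewrite [RHS]big_mkcond /=; apply: eq_bigr => e _.
  rewrite /p /q in_symdiff inE enum_rankK.
  by case: (e \in I); case: (e \in X).
rewrite -det_diagD_pminor; apply: det_dissipative_neq0 => // i; rewrite /p /q.
  by case: ifP => _; rewrite ?oner_eq0 ?Re_gt0_neq0.
by case: ifP => _; rewrite ?divr1 // div1r Re_inv_gt0.
Qed.

End BasisStability.

(** * Coefficient bounds and Gauss-Lucas in one variable *)

Section Univariate.
Variable C : numClosedFieldType.

(** Divided by its constant term the product is that of the [1 - X / z], majorised coefficientwise
    by [(1 + X / d) ^+ size r]. *)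
Lemma prod_XsubC_coef_bound (d : C) (r : seq C) l : 0 < d ->
  (forall z, z \in r -> d <= `|z|) ->
  `|(\prod_(z <- r) ('X - z%:P))`_l| <=
    (1 + d^-1) ^+ size r * `|(\prod_(z <- r) ('X - z%:P))`_0|.
Proof.
move=> d0; elim: r l => [|z r IH] l rd.
  by rewrite big_nil !coef1 mul1r; case: l => [|l] //=; rewrite normr0 normr1.
have {}IH k := IH k (fun y yr => rd y (mem_behead (s := z :: r) yr)).
rewrite big_cons; set q := \prod_(_ <- r) _ in IH *; set K := _ ^+ size r in IH *.
have zd : d <= `|z| by apply: rd; rewrite mem_head.
have K0 : 0 <= K by rewrite exprn_ge0 // addr_ge0 // invr_ge0 ltW.
have -> : (('X - z%:P) * q)`_0 = - z * q`_0.
  by rewrite mulrBl coefB coefXM coefCM sub0r mulNr.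
rewrite mulrBl coefB coefXM coefCM normrM normrN /= exprS -/K.
apply: le_trans (ler_normB _ _) _; rewrite normrM.
have -> : (1 + d^-1) * K * (`|z| * `|q`_0|) =
    (`|z| / d) * (K * `|q`_0|) + `|z| * (K * `|q`_0|) by ring.
apply: lerD; last by rewrite ler_wpM2l.
have zd1 : 1 <= `|z| / d by rewrite ler_pdivlMr // mul1r.
case: ifP => _; first by rewrite normr0 !mulr_ge0 // invr_ge0 ltW.
apply: le_trans (IH _) _; rewrite -[leLHS]mul1r ler_wpM2r // mulr_ge0 //.
Qed.

(* The hypothesis bounds the inverses of the roots, of which the ratios
   [p`_l / p`_0] are elementary symmetric functions. *)
Lemma coef_bound_of_root_free_disc (p : {poly C}) (d : C) N l : 0 < d ->
  (forall y, `|y| < d -> p.[y] != 0) -> (size p <= N)%N ->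
  `|p`_l| <= (1 + d^-1) ^+ N * `|p`_0|.
Proof.
move=> d0 pd pN; have [r pE] := closed_field_poly_normal p.
have p0 : p != 0.
  by apply: contraTneq (pd 0 _) => [->|]; rewrite ?horner0 ?eqxx // normr0.
have lc0 : lead_coef p != 0 by rewrite lead_coef_eq0.
have rd z : z \in r -> d <= `|z|.
  move=> zr; rewrite real_leNgt ?normr_real ?gtr0_real //; apply/negP=> /pd.
  by rewrite pE hornerZ mulf_eq0 (negPf lc0) -rootE root_prod_XsubC zr.
have rN : (size r <= N)%N.
  by apply: leq_trans pN; rewrite pE size_scale // size_prod_XsubC.
rewrite pE !coefZ !normrM mulrCA ler_wpM2l //.
apply: le_trans (prod_XsubC_coef_bound _ d0 rd) _.
by rewrite ler_wpM2r // ler_weXn2l // lerDl invr_ge0 ltW.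
Qed.

Lemma logderiv_prod_XsubC (r : seq C) (s : C) : (forall z, z \in r -> s - z != 0) ->
  (\prod_(z <- r) ('X - z%:P))^`().[s] / (\prod_(z <- r) ('X - z%:P)).[s] =
  \sum_(z <- r) (s - z)^-1.
Proof.
elim: r => [|z r IH] rs; first by rewrite !big_nil derivC horner0 mul0r.
have sz : s - z != 0 by apply: rs; rewrite mem_head.
have rs' y : y \in r -> s - y != 0 by move=> yr; apply: rs; rewrite in_cons yr orbT.
rewrite !big_cons -IH //; set q := \prod_(_ <- r) _.
have q0 : q.[s] != 0.
  rewrite horner_prod prodf_seq_neq0; apply/allP=> y yr.
  by rewrite /= hornerXsubC rs'.
rewrite derivM derivXsubC mul1r !hornerE /=; field.
by rewrite sz q0.
Qed.

(* Gauss-Lucas for the half-plane: [p' / p] is a sum of inverses of numbers with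
   positive real part. *)
Lemma deriv_root_free_halfplane (p : {poly C}) (s : C) :
  (forall y, 0 < 'Re y -> p.[y] != 0) -> (1 < size p)%N -> 0 < 'Re s ->
  p^`().[s] != 0.
Proof.
move=> pst p1 s0; have [r pE] := closed_field_poly_normal p.
have lc0 : lead_coef p != 0 by rewrite lead_coef_eq0 -size_poly_gt0 ltnW.
have rs z : z \in r -> 0 < 'Re (s - z).
  move=> zr; rewrite raddfB /= subr_gt0; apply: le_lt_trans s0.
  rewrite real_leNgt ?Creal_Re //; apply/negP=> /pst.
  by rewrite pE hornerZ mulf_eq0 (negPf lc0) -rootE root_prod_XsubC zr.
have := logderiv_prod_XsubC (fun z zr => Re_gt0_neq0 (rs z zr)).
move=> /(congr1 (fun x => 'Re x)); apply: contra_eqN.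
rewrite {1}pE derivZ hornerZ mulf_eq0 (negPf lc0) => /eqP->.
rewrite mul0r raddf0 raddf_sum /= lt_eqF //.
have : (0 < size r)%N by move: p1; rewrite pE size_scale // size_prod_XsubC.
case: r rs {pE} => [|z r] // rs _; rewrite big_cons ltr_wpDr //.
  by rewrite big_seq sumr_ge0 // => y yr; rewrite ltW // Re_inv_gt0 // rs // in_cons yr orbT.
by rewrite Re_inv_gt0 // rs // mem_head.
Qed.

(** Stands in for letting [s] tend to 0: if [h] were positive, [s = h / (h + T)] would give
    [h + T <= T]. *)
Lemma eq0_of_le_small (h T : C) : 0 <= h -> 0 <= T ->
  (forall s, 0 < s -> s <= 1 -> h <= s * T) -> h = 0.
Proof.
move=> h0 T0 hs; apply/eqP; apply: contraT => hn0.
have hp : 0 < h by rewrite lt_def hn0.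
have hT : 0 < h + T by rewrite ltr_wpDr.
have := hs (h / (h + T)); rewrite divr_gt0 // ler_pdivrMr // mul1r lerDl T0.
move=> /(_ isT isT); rewrite mulrAC ler_pdivlMr // ler_pM2l // gerDr => h0'.
by move: (lt_le_trans hp h0'); rewrite ltxx.
Qed.
End Univariate.

(** * Coefficient extraction from stable polynomials *)

Section Stability.
Variables (C : numClosedFieldType) (M V : finType) (e : V -> M -> nat).
Implicit Types (w : M -> C) (x : V -> C).

(** A polynomial is a weight on a finite set [M] of labels, [e v m] being the exponent of [v] at
    label [m]; several labels may share a monomial. Extracting coefficients only changes weights. *)
Definition mon x m : C := \prod_v x v ^+ e v m.

Definition stable w := forall x, (forall v, 0 < 'Re (x v)) ->
  \sum_m w m * mon x m != 0.

Definition upd x v0 c : V -> C := fun v => if v == v0 then c else x v.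

Lemma eq_stable w w' : w =1 w' -> stable w -> stable w'.
Proof. by move=> ww' st x /st; under eq_bigr do rewrite ww'. Qed.

Lemma mon_upd x v0 c m :
  mon (upd x v0 c) m = c ^+ e v0 m * \prod_(v | v != v0) x v ^+ e v m.
Proof.
rewrite /mon (bigD1 v0) //= /upd eqxx; congr (_ * _).
by apply: eq_bigr => v /negPf->.
Qed.

Lemma mon_scale x v0 c m : mon (upd x v0 (c * x v0)) m = c ^+ e v0 m * mon x m.
Proof. by rewrite mon_upd exprMn -mulrA /mon [in RHS](bigD1 v0). Qed.

Lemma upd_Re x v0 c : (forall v, 0 < 'Re (x v)) -> 0 < 'Re c ->
  forall v, 0 < 'Re (upd x v0 c v).
Proof. by move=> x0 c0 v; rewrite /upd; case: eqP. Qed.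

(* A zero [x] of the limit at [s = 0] would, along the line from [x] to the
   all-ones point, be approached by zeros of the stable polynomials at [s > 0]. *)
Lemma stable_limit w (d : M -> nat) : (forall m, 0 <= w m) ->
  (exists2 m, w m != 0 & d m = 0%N) ->
  (forall s, 0 < s -> s <= 1 -> stable (fun m => w m * s ^+ d m)) ->
  stable (fun m => w m * (d m == 0%N)%:R).
Proof.
move=> w0 [m0 wm0 dm0] st x x0; apply/negP=> /eqP wx.
(* [|y| < D^-1] gives [|(1 - x v) * y| < 'Re (x v)], so the point [x + (1 - x) * y] stays in the
   half-plane. *)
pose D := 1 + \sum_v `|1 - x v| / 'Re (x v).
have D_ge v : `|1 - x v| / 'Re (x v) <= D.
  rewrite /D (bigD1 v) //= addrCA lerDl addr_ge0 ?ler01 // sumr_ge0 // => u _.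
  by rewrite divr_ge0 // ltW.
have D0 : 0 < D.
  by rewrite ltr_wpDr // sumr_ge0 // => v _; rewrite divr_ge0 // ltW.
pose q m : {poly C} := \prod_v ((x v)%:P + (1 - x v) *: 'X) ^+ e v m.
pose h s : {poly C} := \sum_m (w m * s ^+ d m) *: q m.
have qE m y : (q m).[y] = mon (fun v => x v + (1 - x v) * y) m.
  by rewrite horner_prod; apply: eq_bigr => v _; rewrite horner_exp !hornerE.
have hE s y : (h s).[y] = \sum_m w m * s ^+ d m * mon (fun v => x v + (1 - x v) * y) m.
  by rewrite horner_sum; apply: eq_bigr => m _; rewrite hornerZ qE.
have hcoef s l : (h s)`_l = \sum_m s ^+ d m * (w m * (q m)`_l).
  by rewrite coef_sum; apply: eq_bigr => m _; rewrite coefZ; ring.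
pose N := \max_m size (q m).
have hN s : (size (h s) <= N)%N.
  apply: leq_trans (size_sum _ _ _) _; apply/bigmax_leqP=> m _.
  exact: leq_trans (size_scale_leq _ _) (leq_bigmax m).
pose K := (1 + (D^-1)^-1) ^+ N.
have K0 : 0 <= K by rewrite exprn_ge0 // invrK addr_ge0 ?ler01 // ltW.
(* The constant [K] does not depend on [s]; since the constant coefficient tends to 0 with [s], so
   do all the others. *)
have hb s l : 0 < s -> s <= 1 -> `|(h s)`_l| <= K * `|(h s)`_0|.
  move=> s0 s1; apply: coef_bound_of_root_free_disc; rewrite ?invr_gt0 // => y yD.
  rewrite hE; apply: st => // v; rewrite raddfD /=.
  have : `|'Re ((1 - x v) * y)| < 'Re (x v).
    apply: le_lt_trans (leif_normC_Re_Creal _) _; rewrite normrM.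
    have [->|y0] := eqVneq `|y| 0; first by rewrite mulr0.
    have yp : 0 < `|y| by rewrite lt_def y0 normr_ge0.
    have : `|1 - x v| <= D * 'Re (x v) by rewrite -ler_pdivrMr.
    rewrite -(ler_pM2r yp) => /le_lt_trans; apply.
    by rewrite mulrAC gtr_pMl // mulrC -ltr_pdivlMr // div1r.
  rewrite real_ltr_norml ?Creal_Re // => /andP[H _].
  by rewrite -(subrr ('Re (x v))) ltrD2l.
have hd s l : 0 < s -> s <= 1 ->
    `|(h s)`_l - (h 0)`_l| <= s * \sum_m `|w m * (q m)`_l|.
  move=> s0 s1; rewrite !hcoef -sumrB mulr_sumr.
  apply: le_trans (ler_norm_sum _ _ _) _; apply: ler_sum => m _.
  rewrite -mulrBl normrM ler_wpM2r // expr0n; case: (d m) => [|k] /=.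
    by rewrite expr0 subrr normr0 ltW.
  rewrite subr0 ger0_norm; last by rewrite exprn_ge0 // ltW.
  by rewrite exprS ger_pMr // exprn_ile1 // ltW.
have h00 : (h 0)`_0 = 0.
  rewrite -horner_coef0 hE -[RHS]wx; apply: eq_bigr => m _; rewrite expr0n.
  by congr (_ * _); apply: eq_bigr => v _; rewrite mulr0 addr0.
have h0 : h 0 = 0.
  apply/polyP=> l; rewrite coef0; apply/normr0_eq0.
  pose T k := \sum_m `|w m * (q m)`_k|.
  have T0 k : 0 <= T k by rewrite sumr_ge0.
  apply: (@eq0_of_le_small _ _ (T l + K * T 0%N)) => //.
    by rewrite addr_ge0 // mulr_ge0.
  move=> s s0 s1; have := hd s l s0 s1; have := hd s 0%N s0 s1.
  rewrite h00 subr0 -/(T _) -/(T _) => H0 Hl.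
  have -> : (h 0)`_l = (h s)`_l - ((h s)`_l - (h 0)`_l) by ring.
  apply: le_trans (ler_normB _ _) _; rewrite mulrDr addrC lerD // mulrCA.
  by apply: le_trans (hb _ _ s0 s1) _; rewrite ler_wpM2l.
(* At the all-ones point [h 0] is a sum of nonnegative weights, one of them positive. *)
have := hE 0 1; rewrite h0 horner0 => /esym/eqP; apply/negP; rewrite gt_eqF //.
have mon1 m : mon (fun v => x v + (1 - x v) * 1) m = 1.
  by rewrite /mon big1 // => v _; rewrite mulr1 addrC subrK expr1n.
rewrite (bigD1 m0) //= mon1 mulr1 dm0 expr0 mulr1 ltr_wpDr ?lt_def ?wm0 ?w0 //.
by apply: sumr_ge0 => m _; rewrite mon1 mulr1 expr0n mulr_ge0 // ler0n.
Qed.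

(** Scale the variable [v0] by [s], divide by [s ^+ k] and let [s] tend to 0. *)
Lemma stable_min w v0 k : (forall m, 0 <= w m) -> stable w ->
  (forall m, w m != 0 -> (k <= e v0 m)%N) ->
  (exists2 m, w m != 0 & e v0 m = k) ->
  stable (fun m => w m * (e v0 m == k)%:R).
Proof.
move=> w0 st wk [m0 wm0 em0].
apply: (@eq_stable (fun m => w m * ((e v0 m - k)%N == 0%N)%:R)) => [m|].
  have [->|wm] := eqVneq (w m) 0; first by rewrite !mul0r.
  by rewrite subn_eq0 [in RHS]eqn_leq wk // andbT.
apply: stable_limit => //; first by exists m0; rewrite // em0 subnn.
move=> s s0 s1 x x0; have sr : s \is Num.real by rewrite gtr0_real.
have := st (upd x v0 (s * x v0)) (upd_Re _ x0 _).
rewrite ReMl // mulr_gt0 // => /(_ isT).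
apply: contraNneq => wx; apply/eqP.
rewrite (eq_bigr (fun m => s ^+ k * (w m * s ^+ (e v0 m - k) * mon x m))).
  by rewrite -mulr_sumr wx mulr0.
move=> m _; rewrite mon_scale; have [->|wm] := eqVneq (w m) 0; first by rewrite !mul0r mulr0.
by rewrite -{1}(subnK (wk m wm)) exprD; ring.
Qed.

(** As for the minimum, with [v0] scaled by [s^-1] and the sum multiplied by [s ^+ k]. *)
Lemma stable_max w v0 k : (forall m, 0 <= w m) -> stable w ->
  (forall m, w m != 0 -> (e v0 m <= k)%N) ->
  (exists2 m, w m != 0 & e v0 m = k) ->
  stable (fun m => w m * (e v0 m == k)%:R).
Proof.
move=> w0 st wk [m0 wm0 em0].
apply: (@eq_stable (fun m => w m * ((k - e v0 m)%N == 0%N)%:R)) => [m|].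
  have [->|wm] := eqVneq (w m) 0; first by rewrite !mul0r.
  by rewrite subn_eq0 [in RHS]eqn_leq wk.
apply: stable_limit => //; first by exists m0; rewrite // em0 subnn.
move=> s s0 s1 x x0; have sr : s^-1 \is Num.real by rewrite realV gtr0_real.
have sn0 : s != 0 by rewrite gt_eqF.
have := st (upd x v0 (s^-1 * x v0)) (upd_Re _ x0 _).
rewrite ReMl // mulr_gt0 ?invr_gt0 // => /(_ isT).
apply: contraNneq => wx; apply/eqP; apply: (mulfI (expf_neq0 k sn0)).
rewrite mulr0 -[RHS]wx mulr_sumr; apply: eq_bigr => m _.
rewrite mon_scale; have [->|wm] := eqVneq (w m) 0; first by rewrite !mul0r mulr0.
rewrite -{1}(subnK (wk m wm)) exprD exprVn.
rewrite [RHS](_ : _ = s ^+ (k - e v0 m) * (w m * mon x m)); last by ring.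
by field; rewrite expf_neq0.
Qed.

(** Divide by the [i]-th power of [v0], differentiate in [v0], and multiply by the [i.+1]-st power
    to restore the monomials. *)
Lemma stable_deriv w v0 i : (forall m, 0 <= w m) -> stable w ->
  (forall m, w m != 0 -> (i <= e v0 m)%N) ->
  (exists2 m, w m != 0 & (i < e v0 m)%N) ->
  stable (fun m => w m * (e v0 m - i)%N%:R).
Proof.
move=> w0 st wi [m0 wm0 im0] x x0.
pose k := e v0 [arg max_(m > m0 | w m != 0) e v0 m].
have [kmax [m1 wm1 km1]] : (forall m, w m != 0 -> (e v0 m <= k)%N) /\
    (exists2 m, w m != 0 & e v0 m = k).
  by rewrite /k; case: arg_maxnP => // m wm mmax; split=> //; exists m.
have ik : (i < k)%N := leq_trans im0 (kmax _ wm0).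
pose c m := w m * \prod_(v | v != v0) x v ^+ e v m.
pose p : {poly C} := \sum_m c m *: 'X^(e v0 m - i).
have xE m : mon x m = x v0 ^+ e v0 m * \prod_(v | v != v0) x v ^+ e v m.
  by rewrite /mon (bigD1 v0).
have xv0 : x v0 != 0 by rewrite Re_gt0_neq0.
have pst y : 0 < 'Re y -> p.[y] != 0.
  move=> y0; have := st _ (upd_Re v0 x0 y0); apply: contraNneq => py; apply/eqP.
  transitivity (y ^+ i * p.[y]); last by rewrite py mulr0.
  rewrite horner_sum mulr_sumr; apply: eq_bigr => m _.
  rewrite hornerZ hornerXn mon_upd /c; have [->|wm] := eqVneq (w m) 0.
    by rewrite !mul0r mulr0.
  by rewrite -{1}(subnK (wi m wm)) exprD; ring.
(* Gauss-Lucas needs a nonconstant polynomial: the coefficient at the largest exponent [k] is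
   nonzero by [stable_max]. *)
have p1 : (1 < size p)%N.
  have pk : p`_(k - i) != 0.
    have := @stable_max w v0 k w0 st kmax (ex_intro2 _ _ m1 wm1 km1) x x0.
    apply: contraNneq => pk; apply/eqP.
    transitivity (x v0 ^+ k * p`_(k - i)); last by rewrite pk mulr0.
    rewrite coef_sum mulr_sumr; apply: eq_bigr => m _.
    rewrite coefZ coefXn xE /c; have [->|wm] := eqVneq (w m) 0.
      by rewrite !mul0r mulr0.
    have -> : (k - i == e v0 m - i)%N = (e v0 m == k).
      by have := wi m wm; lia.
    by case: eqP => [->|_]; rewrite ?mulr1 ?mulr0 ?mul0r //; ring.
  apply: leq_trans (_ : (k - i).+1 <= _)%N; first by rewrite ltnS subn_gt0.
  by rewrite ltnNge; apply: contraNN pk => /leq_sizeP/(_ _ (leqnn _)) ->.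
have := deriv_root_free_halfplane pst p1 (x0 v0); apply: contraNneq => wx.
apply/eqP; apply: (mulfI (expf_neq0 i.+1 xv0)); rewrite mulr0 -[RHS]wx.
rewrite raddf_sum /= horner_sum mulr_sumr; apply: eq_bigr => m _.
rewrite derivZ derivXn hornerZ hornerMn hornerXn xE /c.
have [->|wm] := eqVneq (w m) 0; first by rewrite !mul0r mulr0.
have := wi m wm; rewrite leq_eqVlt => /orP[/eqP <-|lt_i].
  by rewrite subnn mulr0n !mulr0 mul0r.
have -> : x v0 ^+ e v0 m = x v0 ^+ i.+1 * x v0 ^+ (e v0 m - i).-1.
  by rewrite -exprD; congr (_ ^+ _); lia.
by rewrite -[_ *+ (e v0 m - i)]mulr_natr; ring.
Qed.

(** [k] derivations replace the weights by falling factorials, which kill exponents below [k];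
    exponent [k] is then the least one, with factor [k!]. *)
Lemma stable_coef w v0 k : (forall m, 0 <= w m) -> stable w ->
  (exists2 m, w m != 0 & e v0 m = k) ->
  stable (fun m => w m * (e v0 m == k)%:R).
Proof.
move=> w0 st [m0 wm0 em0].
have wf0 i m : 0 <= w m * (e v0 m ^_ i)%:R by rewrite mulr_ge0 // ler0n.
have wfN0 i m : (w m * (e v0 m ^_ i)%:R != 0) = (w m != 0) && (i <= e v0 m)%N.
  by rewrite mulf_eq0 negb_or pnatr_eq0 -lt0n ffact_gt0.
have ffst i : (i <= k)%N -> stable (fun m => w m * (e v0 m ^_ i)%:R).
  elim: i => [_|i IH ik].
    by apply: eq_stable st => m; rewrite ffactn0 mulr1.
  apply: (@eq_stable (fun m => w m * (e v0 m ^_ i)%:R * (e v0 m - i)%N%:R)).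
    by move=> m; rewrite ffactnSr natrM mulrA.
  apply: stable_deriv (IH (ltnW ik)) _ _ => // [m|]; first by rewrite wfN0 => /andP[].
  by exists m0; rewrite ?wfN0 ?wm0 em0 // ltnW.
have kst : stable (fun m => w m * (e v0 m ^_ k)%:R * (e v0 m == k)%:R).
  apply: stable_min (ffst k (leqnn k)) _ _ => // [m|]; first by rewrite wfN0 => /andP[].
  by exists m0 => //; rewrite wfN0 wm0 em0 leqnn.
move=> x x0; have := kst x x0; apply: contraNneq => wx; apply/eqP.
transitivity (k`!%:R * \sum_m w m * (e v0 m == k)%:R * mon x m); last by rewrite wx mulr0.
rewrite mulr_sumr; apply: eq_bigr => m _; case: eqP => [->|_]; rewrite ?mulr0 ?mul0r ?mulr0 //.
by rewrite ffactnn; ring.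
Qed.

End Stability.

(** * Newton's inequalities *)

Section Newton.
Variable C : numClosedFieldType.

(** If [p] lists the coefficients of a polynomial of degree [n] divided by binomials, [P] is [n.+1]
    times the analogous list for its product with [X + lam]. At [j = 0] the stray [p j.-1] has
    weight 0. *)
Lemma newton_step (n k : nat) (lam : C) (p : nat -> C) : 0 < lam ->
  (forall k, (k <= n)%N -> 0 < p k) ->
  (forall k, (k.+2 <= n)%N -> p k * p k.+2 <= p k.+1 ^+ 2) ->
  (k.+1 <= n)%N ->
  forall P : nat -> C,
    (forall j, P j = j%:R * p j.-1 + (n.+1 - j)%N%:R * lam * p j) ->
  P k * P k.+2 <= P k.+1 ^+ 2.
Proof.
move=> lam0 p0 plc kn P PE.
set a := p k.-1; set b := p k; set c := p k.+1; set d := p k.+2.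
set K : C := k%:R; set L : C := (n - k.+1)%N%:R.
have K0 : 0 <= K by rewrite ler0n.
have L0 : 0 <= L by rewrite ler0n.
have Pk : P k = K * a + (L + 2) * lam * b.
  by rewrite PE /L -natrD; congr (_ + _%:R * _ * _); lia.
have Pk1 : P k.+1 = (K + 1) * b + (L + 1) * lam * c.
  by rewrite PE /L /K !natr1; congr (_ + _%:R * _ * _); lia.
have Pk2 : P k.+2 = (K + 2) * c + L * lam * d.
  by rewrite PE /K -natrD addn2; congr (_ + _%:R * _ * _); lia.
have b0 : 0 < b by apply: p0; lia.
have c0 : 0 < c by apply: p0.
have sq0 : 0 <= (b - lam * c) ^+ 2.
  by rewrite real_exprn_even_ge0 // realB ?realM ?gtr0_real.
have T1 : 0 <= K * (b ^+ 2 - a * c).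
  rewrite /K /a /b /c; case: (k) kn => [|j] jn; first by rewrite mul0r.
  by rewrite mulr_ge0 // subr_ge0 plc.
(* If [k.+1 = n], then [d] is out of range, but its coefficient [L] is 0. *)
have [Ln|Ln] := leqP k.+2 n; last first.
  have -> : P k.+1 ^+ 2 = P k * P k.+2 + ((b - lam * c) ^+ 2 + (K + 2) * (K * (b ^+ 2 - a * c))).
    have L1 : L = 0 by rewrite /L (_ : (n - k.+1)%N = 0%N) //; lia.
    by rewrite Pk Pk1 Pk2 L1; ring.
  by rewrite lerDl addr_ge0 // mulr_ge0 // addr_ge0.
have d0 : 0 < d by apply: p0.
have T2 : 0 <= L * (c ^+ 2 - b * d) by rewrite mulr_ge0 // subr_ge0 plc.
(* Multiply the inequalities [a * c <= b ^+ 2] and [b * d <= c ^+ 2], then cancel [b * c]. *)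
have T3 : 0 <= K * (b * c - a * d).
  rewrite /K; case: (k) @a @b @c @d kn Ln T1 {T2 Pk Pk1 Pk2 sq0} b0 c0 d0
    => [|j] a b c d jn Ln T1 b0 c0 d0.
    by rewrite mul0r.
  rewrite mulr_ge0 // subr_ge0 -(ler_pM2r (mulr_gt0 b0 c0)).
  have -> : a * d * (b * c) = (a * c) * (b * d) by ring.
  have -> : b * c * (b * c) = b ^+ 2 * c ^+ 2 by ring.
  have a0 : 0 < a by apply: p0; rewrite /=; lia.
  by apply: ler_pM; rewrite ?mulr_ge0 ?(ltW a0) ?(ltW b0) ?(ltW c0) ?(ltW d0) // plc.
have -> : P k.+1 ^+ 2 = P k * P k.+2 + ((b - lam * c) ^+ 2 +
    (K + 2) * (K * (b ^+ 2 - a * c)) + (L + 2) * lam ^+ 2 * (L * (c ^+ 2 - b * d)) +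
    L * lam * (K * (b * c - a * d))).
  by rewrite Pk Pk1 Pk2; ring.
have lam0' := ltW lam0; rewrite lerDl.
by do ![done | apply: addr_ge0 | apply: mulr_ge0 | apply: exprn_ge0].
Qed.

(** Induction on the roots; the two absorption identities for binomials turn the recurrence for
    coefficients into the one in [newton_step]. *)
Lemma newton_prod (r : seq C) : (forall z, z \in r -> z < 0) ->
  exists p : nat -> C, [/\ forall k, (k <= size r)%N -> 0 < p k,
    forall k, (k.+2 <= size r)%N -> p k * p k.+2 <= p k.+1 ^+ 2 &
    forall k, (\prod_(z <- r) ('X - z%:P))`_k = 'C(size r, k)%:R * p k].
Proof.
elim: r => [|z r IH] rz.
  exists (fun=> 1); split=> // k.
  by rewrite big_nil coef1 mulr1; case: k.
have [|p [p0 plc pE]] := IH; first by move=> y yr; apply: rz; rewrite in_cons yr orbT.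
have lam0 : 0 < - z by rewrite oppr_gt0 rz // mem_head.
set n := size r in p0 plc pE *.
pose P j := j%:R * p j.-1 + (n.+1 - j)%N%:R * - z * p j.
have n0 : n.+1%:R != 0 :> C by rewrite pnatr_eq0.
exists (fun j => P j / n.+1%:R); split=> /= [k kn|k kn|k].
- rewrite divr_gt0 ?ltr0n // /P.
  case: k kn => [|k] kn.
    by rewrite mul0r add0r !mulr_gt0 ?ltr0n ?p0.
  rewrite ltr_wpDr ?mulr_gt0 ?ltr0n ?p0 //.
  have [->|kn'] := eqVneq k n; first by rewrite subnn !mul0r.
  rewrite !mulr_ge0 ?ler0n ?(ltW lam0) // ltW // p0; lia.
- rewrite mulrACA expr_div_n [X in _ <= _ / X]expr2 invfM ler_wpM2r ?mulr_ge0 ?invr_ge0 ?ler0n //.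
  exact: (newton_step lam0 p0 plc).
- have -> : (\prod_(y <- z :: r) ('X - y%:P))`_k =
      (if k is k'.+1 then 'C(n, k')%:R * p k' else 0) - z * ('C(n, k)%:R * p k).
    by rewrite big_cons mulrBl coefB coefXM coefCM !pE; case: k.
  have E2 : (n.+1%:R : C) * 'C(n, k)%:R = (n.+1 - k)%N%:R * 'C(n.+1, k)%:R.
    by rewrite -!natrM -mul_bin_down.
  apply: (mulfI n0).
  rewrite [RHS](_ : _ = 'C(n.+1, k)%:R * P k); last by rewrite mulrCA [n.+1%:R * _]mulrC divfK.
  rewrite mulrBr [X in _ - X](_ : _ = z * p k * (n.+1%:R * 'C(n, k)%:R)); last by ring.
  rewrite E2 /P; case: k {E2} => [|k]; first by rewrite mulr0 mul0r; ring.
  have E1 : (n.+1%:R : C) * 'C(n, k)%:R = k.+1%:R * 'C(n.+1, k.+1)%:R.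
    by rewrite -!natrM -mul_bin_diag.
  by rewrite [n.+1%:R * (_ * _)]mulrA E1 /=; ring.
Qed.

(** [l] is the multiplicity of the root 0 and [n] the number of negative roots. The inequality is
    cross-multiplied to stay in [nat]. *)
Lemma nonpos_rooted_ulc (s : nat -> nat) N : (forall i, (N <= i)%N -> s i = 0%N) ->
  (exists i, s i != 0%N) ->
  (forall z : C, root (\poly_(i < N) (s i)%:R) z -> z <= 0) ->
  exists l n : nat, (forall i, (s i != 0%N) = (l <= i <= l + n)%N) /\
    forall k, (s (l + k) * s (l + k.+2) * 'C(n, k.+1) ^ 2 <=
               s (l + k.+1) ^ 2 * ('C(n, k) * 'C(n, k.+2)))%N.
Proof.
move=> sN [i0 si0]; set g := \poly_(i < N) _ => groot.
have gE i : g`_i = (s i)%:R.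
  by rewrite coef_poly; case: ltnP => // /sN ->.
have g0 : g != 0.
  by apply: contra_neq si0 => g0; apply/eqP; rewrite -(pnatr_eq0 C) -gE g0 coef0.
have lc0 : 0 < lead_coef g by rewrite lt_def lead_coef_eq0 g0 /lead_coef gE ler0n.
have [r rE] := closed_field_poly_normal g.
have rz z : z \in r -> z <= 0.
  move=> zr; apply: groot; rewrite rE rootE hornerZ mulf_eq0.
  by rewrite -[X in _ || X]rootE root_prod_XsubC zr orbT.
pose l := count (pred1 0) r; pose r' := [seq z <- r | z != 0].
have rE' : \prod_(z <- r) ('X - z%:P) = 'X^l * \prod_(z <- r') ('X - z%:P) :> {poly C}.
  rewrite (bigID (pred1 0)) /= big_filter; congr (_ * _).
  rewrite (eq_bigr (fun=> 'X)); last by move=> z /eqP->; rewrite subr0.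
  by rewrite big_const_seq iter_mulr_1.
have [|p [p0 plc pE]] := @newton_prod r'.
  by move=> z; rewrite mem_filter => /andP[z0 /rz]; rewrite lt_neqAle z0.
set n := size r' in p0 plc pE.
have sE i : ((s i)%:R : C) =
    lead_coef g * (if (i < l)%N then 0 else 'C(n, i - l)%:R * p (i - l)%N).
  by rewrite -gE {1}rE coefZ rE' coefXnM; case: ifP => // _; rewrite pE.
have sEl k : ((s (l + k))%:R : C) = lead_coef g * ('C(n, k)%:R * p k).
  by rewrite sE ltnNge leq_addr /= addKn.
exists l, n; split=> [i|k].
  rewrite -(pnatr_eq0 C) sE mulf_eq0 (gt_eqF lc0) /=.
  have [il|li] := ltnP i l; first by rewrite eqxx.
  rewrite mulf_eq0 pnatr_eq0 -leqn0 negb_or -ltnNge bin_gt0 -(leq_add2l l) subnKC //.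
  case: leqP => //= iln; rewrite gt_eqF // p0 //; lia.
have [kn|kn] := leqP k.+2 n; last first.
  have -> : s (l + k.+2) = 0%N.
    by apply/eqP; rewrite -(pnatr_eq0 C) sEl (bin_small kn) mul0r mulr0.
  by rewrite (bin_small kn) muln0 mul0n.
pose D := (lead_coef g * 'C(n, k.+1)%:R) ^+ 2 * ('C(n, k)%:R * 'C(n, k.+2)%:R).
have EL : (s (l + k) * s (l + k.+2) * 'C(n, k.+1) ^ 2)%N%:R = D * (p k * p k.+2).
  by rewrite !(natrM, natrX) !sEl /D; ring.
have ER : (s (l + k.+1) ^ 2 * ('C(n, k) * 'C(n, k.+2)))%N%:R = D * p k.+1 ^+ 2.
  by rewrite !(natrM, natrX) !sEl /D; ring.
rewrite -(ler_nat C) EL ER ler_wpM2l ?plc // /D.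
have lc0' := ltW lc0.
by do ![done | apply: ler0n | apply: exprn_ge0 | apply: mulr_ge0].
Qed.

End Newton.

(** * Passage to sequences indexed by the integers *)

Lemma ulc_of_nat_seq (s : nat -> nat) (l n : nat) (f : int -> rat) :
  (forall i, (s i != 0%N) = (l <= i <= l + n)%N) ->
  (forall k, (s (l + k) * s (l + k.+2) * 'C(n, k.+1) ^ 2 <=
              s (l + k.+1) ^ 2 * ('C(n, k) * 'C(n, k.+2)))%N) ->
  (forall i : nat, f i = (s i)%:R) -> (forall i : nat, f (Negz i) = 0) ->
  no_internal_zeros f /\ ultra_log_concave f.
Proof.
move=> s0 slc fP fN.
have f0 i : (f i != 0) = (l%:Z <= i <= (l + n)%N%:Z).
  by case: i => i; rewrite ?fP ?fN ?eqxx ?pnatr_eq0 ?s0; lia.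
split=> [i j k|L U [L0 Lmin] [U0 Umax] i]; first by rewrite !f0; lia.
have {L0 Lmin}-> : L = l.
  by apply/eqP; rewrite eq_le Lmin ?f0; move: L0; rewrite ?f0; lia.
have {U0 Umax}-> : U = (l + n)%N.
  by apply/eqP; rewrite eq_le Umax ?f0; move: U0; rewrite ?f0; lia.
have [->|f1] := eqVneq (f (i - 1)) 0; first by rewrite !mul0r sqr_ge0.
have [->|f2] := eqVneq (f (i + 1)) 0; first by rewrite mul0r mulr0 sqr_ge0.
move: f1 f2; rewrite !f0 => f1 f2.
(* Both neighbours of [i] lie in the support, so [i] is interior and all three binomials are
   positive. *)
have [k iE kn] : exists2 k : nat, i = (l + k.+1)%N & (k.+2 <= n)%N.
  by exists (`|i| - l.+1)%N; lia.
have -> : i - 1 = (l + k)%N by lia.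
have -> : i + 1 = (l + k.+2)%N by lia.
rewrite iE !fP.
have bE j : binomz ((l + n)%N%:Z - l%:Z) ((l + j)%N%:Z - l%:Z) = 'C(n, j).
  have -> : (l + n)%N%:Z - l%:Z = n by lia.
  by have -> : (l + j)%N%:Z - l%:Z = j by lia.
rewrite !bE expr_div_n mulf_div.
have C0 j : (j <= n)%N -> 0 < 'C(n, j)%:R :> rat by rewrite ltr0n bin_gt0.
rewrite ler_pdivrMr ?mulr_gt0 ?C0 //; last lia.
rewrite mulrAC ler_pdivlMr ?exprn_gt0 ?C0 //; last lia.
by rewrite -!natrX -!natrM ler_nat slc.
Qed.

(** * Counting tuples by colourings *)

Lemma big_option (R : Type) (idx : R) (op : Monoid.com_law idx) (I : finType)
    (F : option I -> R) :
  \big[op/idx]_o F o = op (F None) (\big[op/idx]_i F (Some i)).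
Proof.
rewrite (bigD1 None) //=; congr (op _ _).
rewrite (reindex_omap (@Some I) id) => [|[]] //=.
by apply: eq_bigl => i; rewrite eqxx.
Qed.

Section Counting.
Variables (C : numClosedFieldType) (E : finType) (B : {set {set E}}).
Variables (R : {set E}) (t : nat) (S : 'I_t -> {set E}) (a : 'I_t -> nat).

(* [Some None] stands for [R] and [Some (Some j)] for [S j]; the extra variable
   [None], allowed on all of [E], keeps every coordinate in the open half-plane. *)
Local Notation V := (option (option 'I_t)).
Local Notation M := {ffun E -> option V}.

Definition block (v : V) : {set E} :=
  match v with None => setT | Some None => R | Some (Some j) => S j end.

(** Tuples of pairwise disjoint sets are encoded as partial colourings of [E], whose fibers are
    disjoint by construction. *)
Definition fiber (g : M) (v : V) : {set E} := [set x | g x == Some v].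

Definition mult (v : V) (g : M) : nat := #|fiber g v|.

Definition supp (g : M) : {set E} := [set x | g x != None].

Definition admissible (g : M) :=
  (supp g \in B) && [forall x, if g x is Some v then x \in block v else true].

(** [js] lists the variables whose coefficient has been extracted so far, for induction. *)
Definition filled (js : seq 'I_t) (g : M) :=
  [&& admissible g, mult None g == 0%N & all (fun j => mult (Some (Some j)) g == a j) js].

Lemma mon_fibers (x : V -> C) (g : M) :
  mon mult x g = \prod_y (if g y is Some v then x v else 1).
Proof.
rewrite /mon; transitivity (\prod_v \prod_y (if g y == Some v then x v else 1)).
  apply: eq_bigr => v _; rewrite -big_mkcond /= -prodr_const.
  by apply: eq_bigl => y; rewrite inE.
rewrite exchange_big; apply: eq_bigr => y _; case: (g y) => [v|]; last by rewrite big1.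
rewrite (bigD1 v) //= eqxx big1 ?mulr1 // => u uv.
by rewrite (inj_eq Some_inj) eq_sym (negPf uv).
Qed.

(** Substituting for each element the sum of the variables whose block contains it, and expanding,
    turns bases into admissible colourings. *)
Lemma stable_admissible : regular_dm B ->
  stable mult (fun g => (admissible g)%:R : C).
Proof.
move=> regB x x0; pose z y := \sum_(v | y \in block v) x v.
have z0 y : 0 < 'Re (z y).
  rewrite raddf_sum /= (bigD1 None) ?inE //= ltr_wpDr // sumr_ge0 // => v _.
  exact: ltW.
have := basis_sum_neq0 regB z0; congr (_ != _).
(* Chosen so that the product over [y] vanishes unless [I] is the support of the colouring and every
   colour is allowed. *)
pose f (I : {set E}) y (o : option V) : C :=
  if o is Some v then if (y \in I) && (y \in block v) then x v else 0
  else (y \notin I)%:R.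
transitivity (\sum_(I in B) \sum_(g : M) \prod_y f I y (g y)).
  apply: eq_bigr => I IB; rewrite -(bigA_distr_bigA (f I)) big_mkcond /=.
  apply: eq_bigr => y _; rewrite big_option /=; case: ifP => yI /=.
    by rewrite add0r -big_mkcond.
  by rewrite big1 ?addr0.
rewrite exchange_big /=; apply: eq_bigr => g _; rewrite mon_fibers /admissible.
have fE I : I != supp g -> \prod_y f I y (g y) = 0.
  move=> Ig; have [y yI] : exists y, (y \in I) != (y \in supp g).
    apply/existsP; apply: contraNT Ig => /existsPn H; apply/eqP/setP=> y.
    by have := H y; rewrite negbK => /eqP.
  rewrite (bigD1 y) //= /f; move: yI; rewrite inE; case: (g y) => [v|] /=.
    by case: (y \in I) => //=; rewrite mul0r.
  by case: (y \in I) => //=; rewrite mul0r.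
have [gB|gB] /= := boolP (supp g \in B); last first.
  by rewrite mul0r big1 // => I IB; apply: fE; apply: contraNneq gB => <-.
rewrite (bigD1 (supp g)) //= [X in _ + X]big1 ?addr0; last by move=> I /andP[_]; apply: fE.
case: forallP => [adm|/forallP].
  rewrite mul1r; apply: eq_bigr => y _; have := adm y; rewrite /f inE.
  by case: (g y) => [v|] //= ->.
rewrite negb_forall mul0r => /existsP[y ny]; rewrite (bigD1 y) //= /f.
by move: ny; case: (g y) => [v|] //= /negPf->; rewrite andbF mul0r.
Qed.

(** [g0] witnesses at each extraction that the coefficient is nonzero. *)
Lemma stable_filled g0 js : regular_dm B -> filled (enum 'I_t) g0 ->
  stable mult (fun g => (filled js g)%:R : C).
Proof.
move=> regB /and3P[adm0 None0 /allP all0].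
have filled0 ks : filled ks g0.
  by rewrite /filled adm0 None0; apply/allP=> j _; rewrite all0 ?mem_enum.
have nz (b : bool) : b -> b%:R != 0 :> C by move=> ->; rewrite oner_eq0.
elim: js => [|j js IH].
  apply: (@eq_stable _ _ _ _ (fun g => (admissible g)%:R * (mult None g == 0%N)%:R)).
    by move=> g; rewrite -natrM mulnb /filled /= andbT.
  apply: stable_coef => [g||]; first exact: ler0n; first exact: stable_admissible.
  by exists g0; [exact: nz | exact/eqP].
apply: (@eq_stable _ _ _ _
    (fun g => (filled js g)%:R * (mult (Some (Some j)) g == a j)%:R)).
  by move=> g; rewrite -natrM mulnb /filled /= -!andbA [in RHS](andbC (_ == a j)).
apply: stable_coef => //.
exists g0; first exact/nz/filled0.
by apply/eqP/all0; rewrite mem_enum.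
Qed.

Lemma card_supp g : #|supp g| = (\sum_v mult v g)%N.
Proof.
have mE v : mult v g = (\sum_y (g y == Some v : nat))%N.
  by rewrite /mult -sum1_card big_mkcond /=; apply: eq_bigr => y _; rewrite inE; case: eqP.
under [RHS]eq_bigr do rewrite mE.
rewrite exchange_big -sum1_card big_mkcond /=; apply: eq_bigr => y _; rewrite inE.
case: (g y) => [v|] /=; last by rewrite big1.
by rewrite (bigD1 v) //= eqxx big1 // => u uv; rewrite (inj_eq Some_inj) eq_sym (negPf uv).
Qed.

(** The basis has [mult (Some None) g] plus the fixed sum of the [a j] elements, and bases share a
    parity. *)
Lemma filled_parity g g' : even_dm B ->
  filled (enum 'I_t) g -> filled (enum 'I_t) g' ->
  odd (mult (Some None) g) = odd (mult (Some None) g').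
Proof.
move=> evB /and3P[/andP[gB _] /eqP n1 /allP a1] /and3P[/andP[gB' _] /eqP n2 /allP a2].
have := evB _ _ gB gB'; rewrite !card_supp (bigD1 (Some None)) //=.
rewrite [in X in _ = X -> _](bigD1 (Some None)) //=.
rewrite (eq_bigr (fun v => mult v g')) ?oddD => [/addIb//|].
case=> [[j|]|] // _; last by rewrite n1 n2.
by rewrite (eqP (a1 j _)) ?(eqP (a2 j _)) // mem_enum.
Qed.

Definition level i := #|[set g | filled (enum 'I_t) g & mult (Some None) g == i]|.

Lemma filled_fiber_None js g : filled js g -> fiber g None = set0.
Proof. by case/and3P=> _ /eqP/cards0_eq. Qed.

Lemma fiber_inj g g' : (forall v, fiber g v = fiber g' v) -> g = g'.
Proof.
move=> gg'; have gE v x : (g x == Some v) = (g' x == Some v).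
  by have /setP/(_ x) := gg' v; rewrite !inE.
apply/ffunP=> x; case gx: (g x) => [v|]; first by apply/esym/eqP; rewrite -gE gx.
by case gx': (g' x) => [v|] //; have := gE v x; rewrite gx gx' eqxx.
Qed.

Lemma disjoint_fiber g u v : u != v -> [disjoint fiber g u & fiber g v].
Proof.
move=> uv; rewrite -setI_eq0; apply/eqP/setP=> x; rewrite !inE.
by case: eqP => [->|//]; rewrite (inj_eq Some_inj) (negPf uv).
Qed.

Lemma supp_fibers g : fiber g None = set0 ->
  supp g = fiber g (Some None) :|: \bigcup_j fiber g (Some (Some j)).
Proof.
move=> g0; apply/setP=> x; rewrite !inE; case gx: (g x) => [[[j|]|]|] /=.
- by apply/esym/bigcupP; exists j; rewrite // inE gx.
- by [].
- by have /setP/(_ x) := g0; rewrite !inE gx eqxx.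
- by apply/esym/bigcupP=> -[j _]; rewrite inE gx.
Qed.

Lemma count_c_level (i : nat) : count_c B R S a i%:Z = level i.
Proof.
pose phi (g : M) := (fiber g (Some None), [ffun j => fiber g (Some (Some j))]).
rewrite /count_c /level -(@card_in_imset _ _ phi) => [|g g']; last first.
  rewrite !inE => /andP[/filled_fiber_None g0 _] /andP[/filled_fiber_None g0' _].
  case=> eqR /ffunP eqS; apply: fiber_inj => -[[j|]|] //; last by rewrite g0.
  by have := eqS j; rewrite !ffunE.
apply: eq_card => -[p1 p2]; rewrite inE /=; apply/idP/imsetP => [|[g]].
- case/and5P=> p1R /eqP[p1i] /forallP p2S /forallP p12 /andP[/forallP p22 pB].
  have dis12 x j : x \in p1 -> x \in p2 j = false.
    by move=> xp1; exact: (disjointFr (p12 j) xp1).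
  have dis22 x j k : x \in p2 j -> x \in p2 k -> j = k.
    move=> xj xk; apply/eqP; have /forallP/(_ k) := p22 j; apply: contraTT => jk.
    by rewrite jk; apply/negP=> d; have := disjointFr d xj; rewrite xk.
  (* The inverse of [phi]; disjointness makes the picked index the only one. *)
  pose g : M := [ffun x => if x \in p1 then Some (Some None) else
    if [pick j | x \in p2 j] is Some j then Some (Some (Some j)) else None].
  have gR : fiber g (Some None) = p1.
    by apply/setP=> x; rewrite !inE ffunE; case: ifP => // _; case: pickP.
  have gS j : fiber g (Some (Some j)) = p2 j.
    apply/setP=> x; rewrite !inE ffunE; case: ifP => [/dis12->//|_].
    case: pickP => [k xk|/(_ j)->//]; apply/eqP/idP => [[<-]//|xj].
    by rewrite (dis22 _ _ _ xk xj).
  have g0 : fiber g None = set0.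
    by apply/setP=> x; rewrite !inE ffunE; case: ifP => // _; case: pickP.
  exists g; last by congr (_, _) => //; apply/ffunP=> j; rewrite ffunE gS.
  rewrite inE /filled /admissible /mult supp_fibers // gR g0 cards0 p1i !eqxx andbT.
  rewrite (eq_bigr p2) ?pB //=.
  apply/andP; split; last first.
    by apply/allP=> j _; have /andP[_] := p2S j; rewrite gS.
  apply/forallP=> x; rewrite ffunE; case: ifP => [/(subsetP p1R)//|_].
  case: pickP => // j xj; have /andP[/subsetP sj _] := p2S j; exact: sj.
- rewrite inE => /andP[fg gi] [-> ->]; have g0 := filled_fiber_None fg.
  have /and3P[/andP[gB /forallP gadm] _ /allP ga] := fg.
  have gsub v : fiber g v \subset block v.
    by apply/subsetP=> x; rewrite inE => /eqP gx; have := gadm x; rewrite gx.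
  apply/and5P; split; first exact: (gsub (Some None)).
  + by rewrite -(eqP gi).
  + apply/forallP=> j; rewrite ffunE (gsub (Some (Some j))) /=.
    by apply: ga; rewrite mem_enum.
  + by apply/forallP=> j; rewrite ffunE disjoint_fiber.
  + apply/andP; split.
      apply/forallP=> j; apply/forallP=> k; apply/implyP=> jk.
      by rewrite !ffunE disjoint_fiber // !(inj_eq Some_inj).
    by under eq_bigr do rewrite ffunE; rewrite -supp_fibers.
Qed.

Lemma sum_halves (g0 : M) (r : C) : even_dm B -> filled (enum 'I_t) g0 ->
  let eps := odd (mult (Some None) g0) in
  \sum_g (filled (enum 'I_t) g)%:R * r ^+ mult (Some None) g =
  r ^+ eps * (\poly_(i < #|E|.+1) (level (i.*2 + eps))%:R).[r ^+ 2].
Proof.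
move=> evB f0 eps; rewrite horner_poly mulr_sumr.
transitivity (\sum_g \sum_(i < #|E|.+1)
    ((filled (enum 'I_t) g) && (mult (Some None) g == i.*2 + eps)%N)%:R * r ^+ (i.*2 + eps)).
  apply: eq_bigr => g _; have [fg|nfg] /= := boolP (filled _ g); last first.
    by rewrite mul0r big1 // => i _; rewrite mul0r.
  have eg : mult (Some None) g = ((mult (Some None) g)./2.*2 + eps)%N.
    by rewrite /eps (filled_parity evB f0 fg) addnC odd_double_half.
  have lt_g : ((mult (Some None) g)./2 < #|E|.+1)%N.
    rewrite ltnS; apply: leq_trans (max_card (mem (fiber g (Some None)))).
    by rewrite -/(mult _ _); lia.
  rewrite (bigD1 (Ordinal lt_g)) //= -eg eqxx big1 ?addr0 // => i ig.
  rewrite eg eqn_add2r; case: eqP => [/double_inj gi|_]; last by rewrite mul0r.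
  by case/eqP: ig; apply: val_inj; rewrite /= gi.
rewrite exchange_big; apply: eq_bigr => i _ /=; rewrite -mulr_suml -exprM mul2n.
rewrite mulrCA -exprD [(eps + _)%N]addnC -natr_sum; congr (_%:R * _).
rewrite /level -[RHS]sum1_card [RHS]big_mkcond /=; apply: eq_bigr => g _.
by rewrite inE; case: (_ && _).
Qed.

(** Neither square root of [z] lies in the open right half-plane, so both are imaginary and [z] is
    minus a real square. *)
Lemma level_root_nonpos (g0 : M) (z : C) : regular_dm B -> filled (enum 'I_t) g0 ->
  let eps := odd (mult (Some None) g0) in
  root (\poly_(i < #|E|.+1) (level (i.*2 + eps))%:R) z -> z <= 0.
Proof.
move=> regB f0 eps /rootP pz.
have Re_le0 r : r ^+ 2 = z -> 'Re r <= 0.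
  move=> rz; rewrite real_leNgt ?Creal_Re //; apply/negP=> r0.
  pose x : V -> C := upd (fun=> 1) (Some None) r.
  have x0 v : 0 < 'Re (x v).
    by apply: upd_Re => // u; rewrite (Creal_ReP _ _) ?ltr01 // real1.
  have := stable_filled (enum 'I_t) regB f0 x0; apply/negP; rewrite negbK.
  have monE g : mon mult x g = r ^+ mult (Some None) g.
    by rewrite mon_upd big1 ?mulr1 // => v _; rewrite expr1n.
  under eq_bigr do rewrite monE.
  by rewrite (sum_halves r (proj1 regB) f0) rz pz mulr0.
have r2 := sqrtCK z; set r := sqrtC z in r2.
have rN2 : (- r) ^+ 2 = z by rewrite sqrrN.
have := Re_le0 _ rN2; rewrite raddfN /= oppr_le0 => r_ge0.
have Re0 : 'Re r = 0 by apply/eqP; rewrite eq_le r_ge0 Re_le0.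
rewrite -r2 (Crect r) Re0 add0r exprMn sqrCi mulN1r oppr_le0.
by rewrite real_exprn_even_ge0 // Creal_Im.
Qed.

End Counting.

Theorem theorem4p7 (E : finType) (B : {set {set E}})
    (HD : is_delta_matroid B) (Hreg : regular_dm B)
    (R : {set E}) (t : nat) (S : 'I_t -> {set E}) (a : 'I_t -> nat) :
  let c := fun i : int => ((count_c B R S a i)%:R : rat) in
  ((forall i : int, c (2 * i) = 0) /\
   no_internal_zeros (fun i => c (2 * i + 1)) /\
   ultra_log_concave (fun i => c (2 * i + 1)))
  \/
  ((forall i : int, c (2 * i + 1) = 0) /\
   no_internal_zeros (fun i => c (2 * i)) /\
   ultra_log_concave (fun i => c (2 * i))).
Proof.
move=> c; pose fl := filled B R S a (enum 'I_t).
have cN i : c (Negz i) = 0.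
  apply/eqP; rewrite pnatr_eq0 cards_eq0; apply/eqP/setP=> p.
  by rewrite !inE /= andbF.
have cP (i : nat) : c i = (level B R S a i)%:R by rewrite /c count_c_level.
have [/existsP[g0 f0]|/existsPn nf] := boolP [exists g, fl g]; last first.
  have c0 i : c i = 0.
    case: i => i; rewrite ?cN // cP; apply/eqP; rewrite pnatr_eq0 cards_eq0.
    by apply/eqP/setP=> g; rewrite !inE; have /negPf := nf g; rewrite /fl => ->.
  (* With no tuple at all the sequence is zero, and having no minimal support index it is vacuously
     ultra-log-concave. *)
  left; split=> [i|]; first exact: c0.
  by split=> [i j k _ _|l u []]; rewrite c0 eqxx.
pose eps := odd (mult (Some None) g0).
have lev0 (k : nat) : odd k != eps -> level B R S a k = 0%N.
  move=> ke; apply/eqP; rewrite cards_eq0; apply/eqP/setP=> g; rewrite !inE.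
  apply/negP=> /andP[fg /eqP gk]; case/eqP: ke.
  by rewrite -gk /eps (filled_parity (proj1 Hreg) fg f0).
pose s i := level B R S a (i.*2 + eps)%N.
have sN i : (#|E|.+1 <= i)%N -> s i = 0%N.
  move=> Ei; apply/eqP; rewrite cards_eq0; apply/eqP/setP=> g; rewrite !inE.
  apply/negP=> /andP[_ /eqP gk]; have := max_card (mem (fiber g (Some None))).
  by rewrite -/(mult _ _) gk; lia.
have s1 : exists i, s i != 0%N.
  exists (mult (Some None) g0)./2; rewrite cards_eq0; apply/set0Pn; exists g0.
  by rewrite inE [filled _ _ _ _ _ _]f0 /= addnC odd_double_half.
have sroot z : root (\poly_(i < #|E|.+1) (s i)%:R) z -> z <= 0 :> algC.
  exact: level_root_nonpos.
have [l [n [s0 slc]]] := nonpos_rooted_ulc sN s1 sroot.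
have ulc f := @ulc_of_nat_seq s l n f s0 slc.
case E1: eps; [left|right]; split.
- case=> i; first by rewrite -PoszM cP lev0 // mul2n odd_double E1.
  by have -> : 2 * Negz i = Negz (2 * i).+1 by [lia]; rewrite cN.
- apply: ulc => i; first by rewrite -PoszM -PoszD cP /s E1 mul2n.
  by have -> : 2 * Negz i + 1 = Negz (2 * i) by [lia]; rewrite cN.
- case=> i; first by rewrite -PoszM -PoszD cP lev0 // mul2n addn1 /= odd_double E1.
  by have -> : 2 * Negz i + 1 = Negz (2 * i) by [lia]; rewrite cN.
- apply: ulc => i; first by rewrite -PoszM cP /s E1 mul2n addn0.
  by have -> : 2 * Negz i = Negz (2 * i).+1 by [lia]; rewrite cN.
Qed.
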